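(* Let $A$ be a positive self-adjoint operator with compact resolvent in a separable Hilbert space $X$, so that its spectrum consists of positive $\lambda_n$, $n\in\mathbb{N}$, with $\lambda_n\to+\infty$. Let $\alpha>0$ and let $f:X^{1/2}\times X\to X$ satisfy, for some $L>0$, $$\|f(u_1,v_1)-f(u_2,v_2)\|\le L\left(\|u_1-u_2\|_{1/2}^2+\|v_1-v_2\|^2\right)^{1/2}$$ for all $u_1,u_2\in X^{1/2}$ and $v_1,v_2\in X$. If $u:[0,T]\to X$ is a nonstationary periodic solution with period $T>0$ of $$\ddot u(t)+\alpha A\dot u(t)+Au(t)=f(u(t),\dot u(t)),\quad t>0,$$ then $$T\ge\frac{1}{L\left(1+\sqrt{\left(1+\frac{1}{\sqrt2}\right)\left(1+\frac{2}{\alpha L}\right)}\right)^2}.$$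
   Context: $X^{1/2}=D(A^{1/2})$ is the fractional power space determined by $A$, with norm $\|u\|_{1/2}=\|A^{1/2}u\|$, where $\|\cdot\|$ is the norm of $X$. Nonstationary means nonconstant. The second order equation is understood as the first order equation $\dot z=\mathbf{A}z+\mathbf{F}(z)$ for $z=(u,v)=(u,\dot u)$ in $\mathbf{X}:=X^{1/2}\times X$ (with scalar product $\langle(u_1,v_1),(u_2,v_2)\rangle=\langle u_1,u_2\rangle_{1/2}+\langle v_1,v_2\rangle$), where $\mathbf{A}(u,v)=(v,-A(\alpha v+u))$ on $D(\mathbf{A})=\{(u,v)\in\mathbf{X}\mid \alpha v+u\in D(A),\ v\in X^{1/2}\}$ and $\mathbf{F}(u,v)=(0,f(u,v))$; $-\mathbf{A}$ is sectorial, so $\mathbf{A}$ generates a $C_0$-semigroup $e^{t\mathbf{A}}$ on $\mathbf{X}$. A periodic solution with period $T$ is one for which $z=(u,\dot u)$, extended $T$-periodically to $\mathbb{R}$, is a continuous $\mathbf{X}$-valued mild solution, i.e. $z(t)=e^{(t-t_0)\mathbf{A}}z(t_0)+\int_{t_0}^t e^{(t-s)\mathbf{A}}\mathbf{F}(z(s))\,ds$ for all real $t_0<t$. *)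

(* Defs.v *)
From Stdlib Require Import Reals Lra ProofIrrelevance Classical.
From Coquelicot Require Import Coquelicot.
Open Scope R_scope.

(** Hilbert spaces are taken over the reals.  A complex Hilbert space is covered
    by restriction of scalars, with [Re <.,.>] as inner product: the notions
    below (self-adjointness, positivity, compact resolvent, square root,
    semigroup) are inherited by the underlying real space. *)
Record HilbertSpace := {
  hilbert_space :> CompleteNormedModule R_AbsRing;
  inner : hilbert_space -> hilbert_space -> R;
  inner_sym : forall x y, inner x y = inner y x;
  inner_plus_l : forall x y z, inner (plus x y) z = inner x z + inner y z;
  inner_scal_l : forall (a : R) x y, inner (scal a x) y = a * inner x y;
  inner_norm : forall x, inner x x = norm x ^ 2
}.
Arguments inner {h} _ _.

Definition separable (V : NormedModule R_AbsRing) : Prop :=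
  exists e : nat -> V,
    forall (x : V) (eps : posreal), exists n, norm (minus (e n) x) < eps.

(** The values of [op_fun] outside [op_dom] carry no meaning. *)
Record operator (X : HilbertSpace) := {
  op_dom : X -> Prop;
  op_fun :> X -> X
}.
Arguments op_dom {X} _ _.
Arguments op_fun {X} _ _.

Definition linear_op {X : HilbertSpace} (A : operator X) : Prop :=
  op_dom A zero /\
  (forall x y, op_dom A x -> op_dom A y ->
     op_dom A (plus x y) /\ A (plus x y) = plus (A x) (A y)) /\
  (forall (a : R) x, op_dom A x ->
     op_dom A (scal a x) /\ A (scal a x) = scal a (A x)).

Definition densely_defined {X : HilbertSpace} (A : operator X) : Prop :=
  forall (x : X) (eps : posreal),
    exists y, op_dom A y /\ norm (minus y x) < eps.

(** The last clause says that the graph of [A] is the graph of its adjoint. *)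
Definition self_adjoint {X : HilbertSpace} (A : operator X) : Prop :=
  linear_op A /\ densely_defined A /\
  forall y w : X,
    (op_dom A y /\ A y = w) <->
    (forall x, op_dom A x -> inner (A x) y = inner x w).

Definition positive_op {X : HilbertSpace} (A : operator X) : Prop :=
  forall x, op_dom A x -> x <> zero -> 0 < inner (A x) x.

Record pos_self_adjoint (X : HilbertSpace) := {
  psa_op :> operator X;
  psa_self_adjoint : self_adjoint psa_op;
  psa_positive : positive_op psa_op
}.
Arguments psa_op {X} _.
Arguments psa_self_adjoint {X} _.
Arguments psa_positive {X} _.

Definition compact_map {X : HilbertSpace} (K : X -> X) : Prop :=
  forall x : nat -> X,
    (exists M : R, forall n, norm (x n) <= M) ->
    exists (phi : nat -> nat) (y : X),
      (forall n, (phi n < phi (S n))%nat) /\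
      filterlim (fun n => K (x (phi n))) eventually (locally y).

(** [Res] is the bounded everywhere defined inverse of [A - mu]. *)
Definition is_resolvent {X : HilbertSpace} (A : operator X) (mu : R)
    (Res : X -> X) : Prop :=
  is_linear Res /\
  (forall x, op_dom A (Res x) /\ minus (A (Res x)) (scal mu (Res x)) = x) /\
  (forall x, op_dom A x -> Res (minus (A x) (scal mu x)) = x).

Definition compact_resolvent {X : HilbertSpace} (A : operator X) : Prop :=
  exists (mu : R) (Res : X -> X), is_resolvent A mu Res /\ compact_map Res.

(** [B = A^{1/2}]: the unique positive self-adjoint operator with [B B = A],
    equality of domains included. *)
Definition is_sqrt_op {X : HilbertSpace} (A B : pos_self_adjoint X) : Prop :=
  forall x,
    (op_dom A x <-> op_dom B x /\ op_dom B (B x)) /\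
    (op_dom A x -> A x = B (B x)).

Lemma norm_minus_self {V : NormedModule R_AbsRing} (x : V) :
  norm (minus x x) = 0.
Proof. now rewrite minus_eq_zero; apply norm_zero. Qed.

Lemma norm_minus_sym {V : NormedModule R_AbsRing} (x y : V) :
  norm (minus x y) = norm (minus y x).
Proof. now rewrite <- norm_opp, opp_minus. Qed.

Lemma norm_minus_triangle {V : NormedModule R_AbsRing} (x y z : V) :
  norm (minus x z) <= norm (minus x y) + norm (minus y z).
Proof. rewrite (minus_trans y x z); apply norm_triangle. Qed.

(** The space [D(B)] with norm [|B u|]; for [B = A^{1/2}] this is [X^{1/2}]. *)
Section DomainSpace.

Context {X : HilbertSpace} (B : pos_self_adjoint X).

Definition domain_space : Type := { x : X | op_dom B x }.

Lemma domain_space_eq (u v : domain_space) :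
  proj1_sig u = proj1_sig v -> u = v.
Proof.
  destruct u as [x Hx], v as [y Hy]; simpl; intros E; subst y.
  f_equal; apply proof_irrelevance.
Qed.

Lemma dom_zero : op_dom B zero.
Proof. exact (proj1 (proj1 (psa_self_adjoint B))). Qed.

Lemma dom_plus x y : op_dom B x -> op_dom B y -> op_dom B (plus x y).
Proof.
  intros Hx Hy.
  exact (proj1 (proj1 (proj2 (proj1 (psa_self_adjoint B))) x y Hx Hy)).
Qed.

Lemma op_plus x y :
  op_dom B x -> op_dom B y -> B (plus x y) = plus (B x) (B y).
Proof.
  intros Hx Hy.
  exact (proj2 (proj1 (proj2 (proj1 (psa_self_adjoint B))) x y Hx Hy)).
Qed.

Lemma dom_scal (a : R) x : op_dom B x -> op_dom B (scal a x).
Proof.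
  intros Hx.
  exact (proj1 (proj2 (proj2 (proj1 (psa_self_adjoint B))) a x Hx)).
Qed.

Lemma op_scal (a : R) x : op_dom B x -> B (scal a x) = scal a (B x).
Proof.
  intros Hx.
  exact (proj2 (proj2 (proj2 (proj1 (psa_self_adjoint B))) a x Hx)).
Qed.

Lemma dom_opp x : op_dom B x -> op_dom B (opp x).
Proof.
  intros Hx.
  exact (eq_ind _ (op_dom B) (dom_scal (-1) x Hx) _
           (scal_opp_one (K := R_AbsRing) x)).
Qed.

Lemma op_opp x : op_dom B x -> B (opp x) = opp (B x).
Proof.
  intros Hx.
  assert (E : forall y : X, opp y = scal (-1 : R_AbsRing) y)
    by (intros y; symmetry; exact (scal_opp_one (K := R_AbsRing) y)).
  transitivity (B (scal (-1 : R_AbsRing) x)).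
  - exact (f_equal B (E x)).
  - exact (eq_trans (op_scal (-1) x Hx) (eq_sym (E (B x)))).
Qed.

Lemma op_minus x y :
  op_dom B x -> op_dom B y -> B (minus x y) = minus (B x) (B y).
Proof.
  intros Hx Hy; unfold minus.
  now rewrite op_plus, op_opp; trivial; apply dom_opp.
Qed.

Definition ds_plus (u v : domain_space) : domain_space :=
  exist _ (plus (proj1_sig u) (proj1_sig v))
    (dom_plus _ _ (proj2_sig u) (proj2_sig v)).
Definition ds_zero : domain_space := exist _ zero dom_zero.
Definition ds_opp (u : domain_space) : domain_space :=
  exist _ (opp (proj1_sig u)) (dom_opp _ (proj2_sig u)).
Definition ds_scal (a : R) (u : domain_space) : domain_space :=
  exist _ (scal a (proj1_sig u)) (dom_scal a _ (proj2_sig u)).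

Definition ds_AbelianMonoid_mixin : AbelianMonoid.mixin_of domain_space.
Proof.
  apply (AbelianMonoid.Mixin _ ds_plus ds_zero); intros;
    apply domain_space_eq; simpl.
  - apply plus_comm.
  - apply plus_assoc.
  - apply plus_zero_r.
Defined.

Canonical ds_AbelianMonoid :=
  AbelianMonoid.Pack domain_space ds_AbelianMonoid_mixin domain_space.

Definition ds_AbelianGroup_mixin : AbelianGroup.mixin_of ds_AbelianMonoid.
Proof.
  apply (AbelianGroup.Mixin ds_AbelianMonoid ds_opp); intros.
  apply domain_space_eq; simpl.
  exact (plus_opp_r (G := X) (proj1_sig x)).
Defined.

Canonical ds_AbelianGroup :=
  AbelianGroup.Pack domain_space
    (AbelianGroup.Class _ _ ds_AbelianGroup_mixin) domain_space.

Definition ds_ModuleSpace_mixin :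
  ModuleSpace.mixin_of R_AbsRing ds_AbelianGroup.
Proof.
  apply (ModuleSpace.Mixin R_AbsRing ds_AbelianGroup ds_scal); intros;
    apply domain_space_eq; simpl.
  - exact (scal_assoc (K := R_AbsRing) x y (proj1_sig u)).
  - exact (scal_one (K := R_AbsRing) (proj1_sig u)).
  - exact (scal_distr_l (K := R_AbsRing) x (proj1_sig u) (proj1_sig v)).
  - exact (scal_distr_r (K := R_AbsRing) x y (proj1_sig u)).
Defined.

Canonical ds_ModuleSpace :=
  ModuleSpace.Pack R_AbsRing domain_space
    (ModuleSpace.Class _ _ _ ds_ModuleSpace_mixin) domain_space.

Definition ds_norm (u : domain_space) : R := norm (B (proj1_sig u)).

Definition ds_ball (u : domain_space) (e : R) (v : domain_space) : Prop :=
  ds_norm (minus v u) < e.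

Lemma ds_norm_minus (u v : domain_space) :
  ds_norm (minus v u) = norm (minus (B (proj1_sig v)) (B (proj1_sig u))).
Proof.
  unfold ds_norm.
  change (proj1_sig (minus v u)) with (minus (proj1_sig v) (proj1_sig u)).
  now rewrite op_minus; [ | apply proj2_sig | apply proj2_sig ].
Qed.

Definition ds_UniformSpace_mixin : UniformSpace.mixin_of domain_space.
Proof.
  apply (UniformSpace.Mixin _ ds_zero ds_ball); unfold ds_ball.
  - intros x e; rewrite ds_norm_minus, (norm_minus_self (V := X)).
    apply cond_pos.
  - intros x y e H; rewrite ds_norm_minus in *.
    now rewrite (norm_minus_sym (V := X)).
  - intros x y z e1 e2 H1 H2; rewrite ds_norm_minus in *.
    eapply Rle_lt_trans;
      [ apply (norm_minus_triangle (V := X) _ (B (proj1_sig y))) | ].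
    rewrite Rplus_comm; now apply Rplus_lt_compat.
Defined.

Canonical ds_UniformSpace :=
  UniformSpace.Pack domain_space ds_UniformSpace_mixin domain_space.

Canonical ds_NormedModuleAux :=
  NormedModuleAux.Pack R_AbsRing domain_space
    (NormedModuleAux.Class R_AbsRing _
       (ModuleSpace.class _ ds_ModuleSpace) ds_UniformSpace_mixin)
    domain_space.

Lemma ds_norm_eq_zero (u : domain_space) : ds_norm u = 0 -> u = ds_zero.
Proof.
  destruct u as [x Hx]; unfold ds_norm; simpl; intros E.
  apply domain_space_eq; simpl.
  apply NNPP; intros Hn.
  generalize (psa_positive B x Hx Hn).
  assert (E0 : B x = scal (0 : R_AbsRing) x).
  { transitivity (zero : X).
    - exact (norm_eq_zero (V := X) (B x) E).
    - exact (eq_sym (scal_zero_l (V := X) x)). }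
  rewrite E0, inner_scal_l, Rmult_0_l.
  apply Rlt_irrefl.
Qed.

Definition ds_NormedModule_mixin :
  NormedModule.mixin_of R_AbsRing ds_NormedModuleAux.
Proof.
  apply (NormedModule.Mixin R_AbsRing ds_NormedModuleAux ds_norm 1).
  - intros x y; unfold ds_norm; simpl.
    rewrite op_plus; [ | apply proj2_sig | apply proj2_sig ].
    exact (norm_triangle (V := X) _ _).
  - intros l x; unfold ds_norm; simpl.
    rewrite op_scal; [ | apply proj2_sig ].
    exact (norm_scal (V := X) l (B (proj1_sig x))).
  - intros x y eps H; exact H.
  - intros x y eps H; rewrite Rmult_1_l; exact H.
  - exact ds_norm_eq_zero.
Defined.

Canonical ds_NormedModule :=
  NormedModule.Pack R_AbsRing domain_space
    (NormedModule.Class R_AbsRing _ _ ds_NormedModule_mixin) domain_space.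

End DomainSpace.

(** [D(B) x X]; the norm of [prod_NormedModule] is
    [sqrt (norm u ^ 2 + norm v ^ 2)]. *)
Definition energy_space {X : HilbertSpace} (B : pos_self_adjoint X) :
    NormedModule R_AbsRing :=
  prod_NormedModule R_AbsRing (ds_NormedModule B) X.

(** [damped_wave_op A B alpha z w] means that [z = (u,v)] lies in the domain of
    [(u,v) |-> (v, - A (alpha v + u))] and is mapped to [w].  The condition
    [v \in D(B)] is part of [w \in D(B) x X]. *)
Definition damped_wave_op {X : HilbertSpace} (A B : pos_self_adjoint X)
    (alpha : R) (z w : energy_space B) : Prop :=
  let av_u := plus (scal alpha (snd z)) (proj1_sig (fst z)) in
  op_dom A av_u /\
  proj1_sig (fst w) = snd z /\
  snd w = opp (A av_u).

Definition C0_semigroup {V : NormedModule R_AbsRing} (S : R -> V -> V) : Prop :=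
  (forall t, 0 <= t -> is_linear (S t)) /\
  (forall z, S 0 z = z) /\
  (forall s t z, 0 <= s -> 0 <= t -> S (s + t) z = S s (S t z)) /\
  (forall z, filterlim (fun t => S t z) (at_right 0) (locally z)).

(** The operator is given by its graph [G]. *)
Definition is_generator {V : NormedModule R_AbsRing} (G : V -> V -> Prop)
    (S : R -> V -> V) : Prop :=
  forall z w,
    G z w <->
    filterlim (fun h => scal (/ h) (minus (S h z) z)) (at_right 0) (locally w).

Definition mild_solution {V : NormedModule R_AbsRing} (S : R -> V -> V)
    (F : V -> V) (z : R -> V) : Prop :=
  forall t0 t, t0 < t ->
    exists I : V,
      is_RInt (fun s => S (t - s) (F (z s))) t0 t I /\
      z t = plus (S (t - t0) (z t0)) I.

(** [z] is the [T]-periodic extension of [(u, u')] to the whole line; only the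
    values of [u] on [[0,T]] matter. *)
Definition periodic_solution {X : HilbertSpace} (B : pos_self_adjoint X)
    (S : R -> energy_space B -> energy_space B)
    (f : domain_space B -> X -> X) (T : R) (u : R -> X) : Prop :=
  exists z : R -> energy_space B,
    (forall t, 0 <= t <= T -> u t = proj1_sig (fst (z t))) /\
    (forall t, is_derive (fun s => proj1_sig (fst (z s)) : X) t (snd (z t))) /\
    (forall t, z (t + T) = z t) /\
    (forall t, continuous z t) /\
    mild_solution S (fun y => (zero, f (fst y) (snd y))) z.

(* Main.v *)
Require Import Defs.
From Stdlib Require Import Reals Lra Lia Classical ClassicalEpsilon ssreflect.
From Coquelicot Require Import Coquelicot.
Open Scope R_scope.

(** Fix [s] and compare the solution with its translate.  Formally
    [w(t) = u(t + s) - u(t)] is periodic with mean zero and solves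
    [w'' + alpha A w' + A w = g], where
    [int |g|^2 <= L^2 int (|B w|^2 + |w'|^2)] and [B = A^{1/2}].
    Testing with [w'] and [w], and using the (crude) Poincare inequality
    [int |phi|^2 <= T^2 int |phi'|^2] for mean-zero [phi], one finds
    [int (|B w|^2 + |w'|^2) <= (1 / (5 L^2)) int |g|^2] as soon as
    [T L <= 1/5] and [T <= 3 alpha / 10], which the negation of the claimed
    bound implies.  Hence [w = 0].

    Mild solutions lack the regularity needed for these computations, so they
    are carried out for [int_t^{t+h} w], which lies in the domain of the
    generator; the factor [1/5] (instead of [1]) leaves room for the error,
    which is uniformly small for small [h].  That time integrals of a mild
    solution lie in the domain requires [S] to be bounded near [0], hence the
    uniform boundedness principle and the completeness of [D(B) x X]; the
    latter comes from the compactness of the resolvent. *)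

(** * Norms and inner products *)

(** The hypothesis on [f] controls only differences of its values, so the forcing has to be compared
    at two points of the orbit; a translate supplies the second point. Testing with [w'] is what
    uses the damping: the other terms on the left are derivatives of periodic functions, so
    [alpha int |B w'|^2] is bounded by the forcing, and Poincare turns this into a bound of
    [int |B w|^2]. Testing with [w] then converts potential energy into kinetic energy.

    The smallness needed is far from sharp: the square in the claimed bound is at least
    [53/10 + 34 / (10 alpha L)], which is why a Poincare constant [T^2] is enough.

    The room left by [1/5] is spent on squares: replacing a window integral by [h] times its
    integrand costs a factor 2 in the energy and another in the forcing, so [1/5] becomes [4/5],
    still below 1, and a bound of the increments by an arbitrarily small error survives. *)

Section ProductNorm.

Context {U V : NormedModule R_AbsRing}.
Implicit Types p : prod_NormedModule R_AbsRing U V.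

Lemma prod_norm_sqr p : norm p ^ 2 = norm (fst p) ^ 2 + norm (snd p) ^ 2.
Proof.
  apply pow2_sqrt, Rplus_le_le_0_compat; apply pow2_ge_0.
Qed.

Lemma norm_fst_le p : norm (fst p) <= norm p.
Proof.
  apply Rsqr_incr_0_var; [ | apply norm_ge_0].
  rewrite !Rsqr_pow2 prod_norm_sqr; generalize (pow2_ge_0 (norm (snd p))); lra.
Qed.

Lemma norm_snd_le p : norm (snd p) <= norm p.
Proof.
  apply Rsqr_incr_0_var; [ | apply norm_ge_0].
  rewrite !Rsqr_pow2 prod_norm_sqr; generalize (pow2_ge_0 (norm (fst p))); lra.
Qed.

End ProductNorm.

Section InnerProduct.

Context {X : HilbertSpace}.
Implicit Types x y z e : X.

Lemma inner_plus_r x y z : inner x (plus y z) = inner x y + inner x z.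
Proof. now rewrite inner_sym inner_plus_l !(inner_sym _ x). Qed.

Lemma inner_scal_r (a : R) x y : inner x (scal a y) = a * inner x y.
Proof. now rewrite inner_sym inner_scal_l (inner_sym _ x). Qed.

Lemma inner_opp_l x y : inner (opp x) y = - inner x y.
Proof.
  replace (opp x) with (scal (-1 : R_AbsRing) x)
    by exact (scal_opp_one (K := R_AbsRing) x).
  rewrite inner_scal_l; ring.
Qed.

Lemma inner_opp_r x y : inner x (opp y) = - inner x y.
Proof. now rewrite inner_sym inner_opp_l (inner_sym _ x). Qed.

Lemma inner_minus_l x y z : inner (minus x y) z = inner x z - inner y z.
Proof. unfold minus; now rewrite inner_plus_l inner_opp_l. Qed.

Lemma inner_minus_r x y z : inner x (minus y z) = inner x y - inner x z.
Proof. unfold minus; now rewrite inner_plus_r inner_opp_r. Qed.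

Lemma inner_zero_l x : inner zero x = 0.
Proof.
  replace (zero : X) with (minus x x) by exact (minus_eq_zero (G := X) x).
  rewrite inner_minus_l; ring.
Qed.

Lemma inner_zero_r x : inner x zero = 0.
Proof. now rewrite inner_sym inner_zero_l. Qed.

Lemma inner_ext x y : (forall e, inner x e = inner y e) -> x = y.
Proof.
  intros H.
  apply (ball_norm_eq (V := X)); intros eps; unfold ball_norm.
  assert (E : norm (minus y x) ^ 2 = 0)
    by (rewrite -inner_norm inner_minus_l !H; ring).
  assert (E0 : norm (minus y x) = 0).
  { apply Rsqr_0_uniq; unfold Rsqr; rewrite -E; ring. }
  rewrite E0; apply cond_pos.
Qed.

Lemma inner_self_ge_0 x : 0 <= inner x x.
Proof. rewrite inner_norm; apply pow2_ge_0. Qed.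

(* Expanding [0 <= |k x - y|^2 / k]. *)
Lemma inner_young (k : R) x y : 0 < k ->
  2 * inner x y <= k * norm x ^ 2 + norm y ^ 2 / k.
Proof.
  intros Hk.
  generalize (inner_self_ge_0 (minus (scal k x) y)).
  rewrite inner_minus_l !inner_minus_r !inner_scal_l !inner_scal_r.
  rewrite (inner_sym _ y x) -!inner_norm; intros H.
  apply Rmult_le_reg_l with k; trivial.
  replace (k * (k * inner x x + inner y y / k))
    with (k * k * inner x x + inner y y) by (field; lra).
  lra.
Qed.

Lemma inner_le x y : inner x y <= norm x * norm y.
Proof.
  destruct (Req_dec (norm x) 0) as [Ex | Nx].
  { rewrite (norm_eq_zero (V := X) x Ex) inner_zero_l (norm_zero (V := X)).
    lra. }
  destruct (Req_dec (norm y) 0) as [Ey | Ny].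
  { rewrite (norm_eq_zero (V := X) y Ey) inner_zero_r (norm_zero (V := X)).
    lra. }
  assert (Hx := norm_ge_0 (V := X) x); assert (Hy := norm_ge_0 (V := X) y).
  assert (Hk : 0 < norm y / norm x) by (apply Rdiv_lt_0_compat; lra).
  assert (H := inner_young (norm y / norm x) x y Hk).
  replace (norm y / norm x * norm x ^ 2) with (norm x * norm y) in H
    by (field; lra).
  replace (norm y ^ 2 / (norm y / norm x)) with (norm x * norm y) in H
    by (field; lra).
  lra.
Qed.

Lemma Rabs_inner_le x y : Rabs (inner x y) <= norm x * norm y.
Proof.
  apply Rabs_le; split; [ | apply inner_le].
  assert (H := inner_le (opp x) y).
  rewrite inner_opp_l (norm_opp (V := X)) in H; lra.
Qed.

Lemma is_linear_inner_l y : is_linear (fun x : X => inner x y : R).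
Proof.
  split.
  - intros; apply inner_plus_l.
  - intros; apply inner_scal_l.
  - exists (norm y + 1); split.
    + generalize (norm_ge_0 (V := X) y); lra.
    + intros x; eapply Rle_trans; [apply Rabs_inner_le | ].
      generalize (norm_ge_0 (V := X) x) (norm_ge_0 (V := X) y).
      nra.
Qed.

Lemma norm_plus_sqr_le x y :
  norm (plus x y) ^ 2 <= 2 * norm x ^ 2 + 2 * norm y ^ 2.
Proof.
  generalize (inner_self_ge_0 (minus x y)).
  rewrite -!inner_norm.
  rewrite inner_minus_l !inner_minus_r inner_plus_l !inner_plus_r.
  lra.
Qed.

(** The increment of a bilinear form minus its linear part is exactly [inner (fst d) (snd d)], hence
    at most [norm d ^ 2]. *)
Lemma filterdiff_inner (p : X * X) :
  filterdiff
    (fun q : prod_NormedModule R_AbsRing X X => inner (fst q) (snd q) : R)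
    (locally p)
    (fun q => inner (fst q) (snd p) + inner (fst p) (snd q)).
Proof.
  split.
  - split.
    + intros q q'; simpl.
      change (fst (plus q q')) with (plus (fst q) (fst q')).
      change (snd (plus q q')) with (plus (snd q) (snd q')).
      rewrite inner_plus_l inner_plus_r; unfold plus; simpl; ring.
    + intros k q.
      change (fst (scal k q)) with (scal k (fst q)).
      change (snd (scal k q)) with (scal k (snd q)).
      rewrite inner_scal_l inner_scal_r; unfold scal; simpl.
      unfold mult; simpl; ring.
    + exists (norm (fst p) + norm (snd p) + 1).
      assert (H1 := norm_ge_0 (V := X) (fst p)).
      assert (H2 := norm_ge_0 (V := X) (snd p)).
      split; [lra | intros q].
      eapply Rle_trans; [apply Rabs_triang | ].
      eapply Rle_trans;
        [apply Rplus_le_compat; apply Rabs_inner_le | ].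
      assert (Ha := norm_fst_le q); assert (Hb' := norm_snd_le q).
      assert (H3 := norm_ge_0 (V := X) (fst q)).
      assert (H4 := norm_ge_0 (V := X) (snd q)).
      nra.
  - intros q Hq eps.
    assert (E : q = p).
    { symmetry; apply is_filter_lim_locally_unique; exact Hq. }
    subst q.
    apply (filter_imp (F := locally (T := prod_NormedModule R_AbsRing X X) p)
             (ball_norm (V := prod_NormedModule R_AbsRing X X) p eps)).
    2: apply (locally_ball_norm (V := prod_NormedModule R_AbsRing X X)).
    intros q Hb; unfold ball_norm in Hb.
    set (d := minus q p) in *.
    change (Rabs (inner (fst q) (snd q) - inner (fst p) (snd p)
                  - (inner (fst d) (snd p) + inner (fst p) (snd d)))
            <= eps * norm d).
    replace (inner (fst q) (snd q) - inner (fst p) (snd p)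
             - (inner (fst d) (snd p) + inner (fst p) (snd d)))
      with (inner (fst d) (snd d)).
    2: { change (fst d) with (minus (fst q) (fst p)).
         change (snd d) with (minus (snd q) (snd p)).
         rewrite !inner_minus_l !inner_minus_r; ring. }
    eapply Rle_trans; [apply Rabs_inner_le | ].
    assert (Ha := norm_fst_le d); assert (Hb' := norm_snd_le d).
    assert (H3 := norm_ge_0 (V := X) (fst d)).
    assert (H4 := norm_ge_0 (V := X) (snd d)).
    nra.
Qed.

Lemma is_derive_inner (f g : R -> X) (t : R) (df dg : X) :
  is_derive f t df -> is_derive g t dg ->
  is_derive (fun s => inner (f s) (g s)) t (inner df (g t) + inner (f t) dg).
Proof.
  intros Hf Hg.
  unfold is_derive.
  eapply filterdiff_ext_lin.
  - apply (filterdiff_comp_2 (K := R_AbsRing) (T := R_NormedModule)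
             (U := X) (V := X) (W := R_NormedModule) f g inner _ _
             (fun a b => inner a (g t) + inner (f t) b) Hf Hg).
    assert (Hc := filterdiff_inner (f t, g t)).
    destruct Hc as [Hl Hd]; split; [exact Hl | ].
    intros q Hq.
    (* [filterdiff_comp_2] asks for differentiability along the image filter of [s |-> (f s, g s)],
       which is finer than the neighbourhoods of [(f t, g t)]. *)
    assert (Hp : filter_le (filtermap (fun s => (f s, g s)) (locally t))
                   (locally (f t, g t))).
    { intros P [eps HP].
      assert (Hpair : filterlim (fun s => (f s, g s)) (locally t)
                        (filter_prod (locally (f t)) (locally (g t)))).
      2: { apply Hpair.
           exists (ball (f t) eps) (ball (g t) eps); try apply locally_ball.
           intros a b Ha Hb; apply HP; split; assumption. }
      apply filterlim_pair.
      - apply (ex_derive_continuous (K := R_AbsRing) f); now exists df.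
      - apply (ex_derive_continuous (K := R_AbsRing) g); now exists dg. }
    eapply is_domin_le; [ | exact Hp].
    apply Hd.
    assert (E : q = (f t, g t)).
    { apply (is_filter_lim_unique (V := prod_NormedModule R_AbsRing X X)
               (F := filtermap (fun s => (f s, g s)) (locally t)));
        assumption. }
    rewrite E; intros P HP; exact HP.
  - intros y; cbv beta.
    rewrite inner_scal_l inner_scal_r; unfold scal; simpl; unfold mult; simpl.
    ring.
Qed.

Lemma continuous_inner (f g : R -> X) (t : R) :
  continuous f t -> continuous g t ->
  continuous (fun s => inner (f s) (g s) : R) t.
Proof.
  intros Hf Hg.
  apply (continuous_comp_2 (U := R_UniformSpace) (V := X) (W := X)
           (X := R_UniformSpace) f g inner); trivial.
  apply (filterdiff_continuous (K := R_AbsRing)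
           (U := prod_NormedModule R_AbsRing X X) (V := R_NormedModule)
           (fun q => inner (fst q) (snd q))).
  eexists; apply filterdiff_inner.
Qed.

End InnerProduct.

(** * Completeness of the energy space *)

(** The reverse of the norm axiom comes from applying that axiom to [/ k]. *)
Lemma norm_scal_Rabs {V : NormedModule R_AbsRing} (k : R) (x : V) :
  norm (scal k x) = Rabs k * norm x.
Proof.
  apply Rle_antisym; [apply (norm_scal k x) | ].
  destruct (Req_dec k 0) as [-> | Nk].
  { rewrite Rabs_R0 Rmult_0_l; apply norm_ge_0. }
  assert (Hk := Rabs_pos_lt k Nk).
  assert (H := norm_scal (/ k) (scal k x)).
  rewrite scal_assoc in H.
  change (mult (/ k) k) with (/ k * k) in H.
  rewrite Rinv_l // in H.
  change (abs (/ k)) with (Rabs (/ k)) in H.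
  rewrite (scal_one (K := R_AbsRing)) Rabs_inv in H.
  apply Rmult_le_reg_l with (/ Rabs k); [now apply Rinv_0_lt_compat | ].
  rewrite -Rmult_assoc Rinv_l; lra.
Qed.

Lemma norm_prod_le {U V : NormedModule R_AbsRing}
    (p : prod_NormedModule R_AbsRing U V) :
  norm p <= norm (fst p) + norm (snd p).
Proof.
  assert (Hf := norm_ge_0 (fst p)); assert (Hs := norm_ge_0 (snd p)).
  apply Rsqr_incr_0_var; [ | lra].
  rewrite !Rsqr_pow2 prod_norm_sqr; nra.
Qed.

(** * Riemann integrals under bounded linear maps *)

Section RIntLinear.

Context {U V : NormedModule R_AbsRing}.

Lemma Riemann_sum_linear (l : U -> V) (f : R -> U) (ptd : SF_seq) :
  is_linear l -> Riemann_sum (fun t => l (f t)) ptd = l (Riemann_sum f ptd).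
Proof.
  intros Hl.
  induction ptd using SF_cons_ind.
  - symmetry; apply (linear_zero l Hl).
  - rewrite !Riemann_sum_cons IHptd (linear_plus l Hl) (linear_scal l Hl).
    reflexivity.
Qed.

Lemma is_RInt_linear (l : U -> V) (f : R -> U) (a b : R) (I : U) :
  is_linear l -> is_RInt f a b I -> is_RInt (fun t => l (f t)) a b (l I).
Proof.
  intros Hl Hf; unfold is_RInt.
  apply (filterlim_ext
           (fun ptd => l (scal (sign (b - a)) (Riemann_sum f ptd)))).
  - intros ptd; rewrite (linear_scal l Hl) (Riemann_sum_linear l f ptd Hl).
    reflexivity.
  - apply (filterlim_comp _ _ _ _ l _ _ _ Hf), (linear_cont l I Hl).
Qed.

(** The value [I] is given in [U], so convergence of the Riemann sums can be tested after [l]. This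
    turns integrals of [B u] in [X] into integrals in [D(B)], whose structure carries no
    completeness. *)
Lemma is_RInt_linear_isometry (l : U -> V) (f : R -> U) (a b : R) (I : U) :
  is_linear l -> (forall x, norm (l x) = norm x) ->
  is_RInt (fun t => l (f t)) a b (l I) -> is_RInt f a b I.
Proof.
  intros Hl Hi Hf; unfold is_RInt in *.
  apply filterlim_locally_ball_norm; intros eps.
  apply (filterlim_locally_ball_norm (U := V)) with (eps := eps) in Hf.
  revert Hf; apply filter_imp; intros ptd H; unfold ball_norm in *.
  rewrite -Hi (linear_minus l _ _ Hl) (linear_scal l Hl)
    -(Riemann_sum_linear l f ptd Hl).
  exact H.
Qed.

End RIntLinear.

(** * The square root: closedness, commutation with resolvents, coercivity *)

Section SquareRoot.

Context {X : HilbertSpace} (B : pos_self_adjoint X).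

Lemma op_symmetric (x y : X) :
  op_dom B x -> op_dom B y -> inner (B x) y = inner x (B y).
Proof.
  intros Hx Hy.
  destruct (psa_self_adjoint B) as (_ & _ & H).
  exact (proj1 (H y (B y)) (conj Hy eq_refl) x Hx).
Qed.

Lemma op_adjoint (y w : X) :
  (forall x, op_dom B x -> inner (B x) y = inner x w) ->
  op_dom B y /\ B y = w.
Proof.
  destruct (psa_self_adjoint B) as (_ & _ & H); apply H.
Qed.

Lemma op_injective (x : X) : op_dom B x -> B x = zero -> x = zero.
Proof.
  intros Hx E; apply NNPP; intros N.
  generalize (psa_positive B x Hx N); rewrite E inner_zero_l; lra.
Qed.

(** An adjoint has a closed graph: for fixed [e] both sides of the symmetry relation pass to the
    limit. *)
Lemma op_closed (x : nat -> X) (y w : X) :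
  (forall n, op_dom B (x n)) ->
  filterlim x eventually (locally y) ->
  filterlim (fun n => B (x n)) eventually (locally w) ->
  op_dom B y /\ B y = w.
Proof.
  intros Hx Hy Hw; apply op_adjoint; intros e He.
  assert (L1 : is_lim_seq (fun n => inner (x n) (B e)) (inner y (B e))).
  { apply (filterlim_comp _ _ _ x (fun a => inner a (B e) : R) _ _ _ Hy).
    apply (linear_cont _ y (is_linear_inner_l (B e))). }
  assert (L2 : is_lim_seq (fun n => inner (B (x n)) e) (inner w e)).
  { apply (filterlim_comp _ _ _ _ (fun a => inner a e : R) _ _ _ Hw).
    apply (linear_cont _ w (is_linear_inner_l e)). }
  apply is_lim_seq_ext with (v := fun n => inner (x n) (B e)) in L2.
  2: intros n; apply op_symmetric; auto.
  apply is_lim_seq_unique in L1; apply is_lim_seq_unique in L2.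
  rewrite L1 in L2; injection L2 as L2.
  now rewrite (inner_sym _ (B e)) (inner_sym _ e).
Qed.

Definition ds_embed (u : ds_NormedModule B) : X := B (proj1_sig u).

Lemma norm_ds_embed (u : ds_NormedModule B) : norm (ds_embed u) = norm u.
Proof. reflexivity. Qed.

Lemma is_linear_ds_embed : is_linear ds_embed.
Proof.
  split.
  - intros x y; apply op_plus; apply proj2_sig.
  - intros k x; apply op_scal, proj2_sig.
  - exists 1; split; [lra | intros x; rewrite norm_ds_embed; lra].
Qed.

Context (A : pos_self_adjoint X) (hAB : is_sqrt_op A B).

Lemma op_dom_of_sqrt (x : X) :
  op_dom A x -> op_dom B x /\ op_dom B (B x) /\ A x = B (B x).
Proof.
  intros Hx; destruct (hAB x) as [[H _] E].
  destruct (H Hx); auto.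
Qed.

(** With [y = Res x], the identity [B (B y) = x + mu y] puts [B (B y)] in [D(B)], hence [B y] in the
    domain of [A]; then [(A - mu) (B y) = B x], and [Res] is applied. *)
Lemma resolvent_commutes_sqrt (mu : R) (Res : X -> X) (x : X) :
  is_resolvent A mu Res -> op_dom B x ->
  op_dom B (Res x) /\ B (Res x) = Res (B x).
Proof.
  intros (_ & Hr & Hl) Hx.
  destruct (Hr x) as [Hy Ey]; set (y := Res x) in *.
  destruct (op_dom_of_sqrt y Hy) as (Dy & DBy & EA).
  split; trivial.
  assert (EBB : B (B y) = plus x (scal mu y)).
  { apply inner_ext; intros e.
    assert (E := f_equal (fun v => inner v e) Ey); cbv beta in E.
    rewrite inner_minus_l EA in E; rewrite inner_plus_l; lra. }
  assert (DABy : op_dom A (B y)).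
  { apply hAB; split; trivial.
    rewrite EBB; apply dom_plus; [ | apply dom_scal]; trivial. }
  rewrite -{1}(Hl (B y) DABy); f_equal.
  destruct (op_dom_of_sqrt _ DABy) as (_ & _ & EAB).
  rewrite EAB EBB op_plus ?op_scal //; try apply dom_scal; trivial.
  apply inner_ext; intros e; rewrite inner_minus_l inner_plus_l; ring.
Qed.

(* If [|x_n| = 1] and [B x_n -> 0], compactness gives [Res x_n -> y] along a
   subsequence, and [B Res x_n = Res B x_n -> 0] forces [B y = 0], [y = 0];
   then [1 = <(A - mu) Res x_n, x_n> = <B Res x_n, B x_n> - mu <Res x_n, x_n>]
   tends to [0]. *)
Lemma sqrt_coercive (hA : compact_resolvent A) :
  exists C, 0 < C /\ forall x, op_dom B x -> norm x <= C * norm (B x).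
Proof.
  destruct hA as (mu & Res & HR & Hc).
  apply NNPP; intros N.
  assert (Hn : forall n : nat, exists x, op_dom B x /\ norm x = 1 /\
                 norm (B x) <= / (INR n + 1)).
  { intros n; apply NNPP; intros Nn; apply N.
    assert (Hn := pos_INR n).
    exists (INR n + 1); split; [lra | intros x Hx].
    apply Rnot_lt_le; intros Hlt; apply Nn.
    assert (HB := norm_ge_0 (V := X) (B x)).
    assert (Hx0 : 0 < norm x) by nra.
    exists (scal (/ norm x) x).
    assert (Hi : Rabs (/ norm x) = / norm x)
      by (apply Rabs_pos_eq, Rlt_le, Rinv_0_lt_compat, Hx0).
    assert (EN : forall y : X, norm (scal (/ norm x) y) = / norm x * norm y)
      by (intros y; rewrite (norm_scal_Rabs (V := X)); now rewrite Hi).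
    split; [now apply dom_scal | ].
    rewrite op_scal // !EN; split; [field; lra | ].
    apply Rmult_le_reg_l with (norm x * (INR n + 1)); [nra | ].
    replace (norm x * (INR n + 1) * (/ norm x * norm (B x)))
      with ((INR n + 1) * norm (B x)) by (field; lra).
    replace (norm x * (INR n + 1) * / (INR n + 1)) with (norm x)
      by (field; lra).
    lra. }
  set (x := fun n => proj1_sig (constructive_indefinite_description _ (Hn n))).
  assert (Hx : forall n, op_dom B (x n) /\ norm (x n) = 1 /\
                 norm (B (x n)) <= / (INR n + 1)).
  { intros n.
    apply (proj2_sig (constructive_indefinite_description _ (Hn n))). }
  clearbody x; clear Hn N.
  destruct (Hc x) as (phi & y & Hphi & Hy).
  { exists 1; intros n; right; apply Hx. }
  destruct (linear_norm _ (proj1 HR)) as (M & HM & HRM).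
  assert (Hge : forall k, (k <= phi k)%nat).
  { induction k as [ | k IH]; [lia | specialize (Hphi k); lia]. }
  assert (HBx : forall k, norm (B (x (phi k))) <= / (INR k + 1)).
  { intros k; eapply Rle_trans; [apply Hx | ].
    assert (H := le_INR _ _ (Hge k)); assert (H0 := pos_INR k).
    apply Rinv_le_contravar; lra. }
  assert (HBy : forall k, norm (B (Res (x (phi k)))) <= M * / (INR k + 1)).
  { intros k.
    destruct (resolvent_commutes_sqrt mu Res (x (phi k)) HR) as [_ E];
      [apply Hx | rewrite E].
    eapply Rle_trans; [apply HRM | ].
    apply Rmult_le_compat_l; [lra | apply HBx]. }
  assert (Hinv : forall eps : posreal,
             eventually (fun k => M * / (INR k + 1) < eps)).
  { intros eps.
    assert (L : is_lim_seq (fun k => M * / INR k) (M * 0)).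
    { apply (is_lim_seq_scal_l _ M 0), (is_lim_seq_inv _ p_infty);
        [apply is_lim_seq_INR | discriminate]. }
    rewrite Rmult_0_r in L; apply is_lim_seq_spec in L.
    destruct (L eps) as [n0 Hn0]; exists n0; intros k Hk.
    specialize (Hn0 (S k) ltac:(lia)).
    rewrite Rminus_0_r S_INR in Hn0.
    eapply Rle_lt_trans; [apply Rle_abs | exact Hn0]. }
  assert (E0 : y = zero).
  { assert (HC : op_dom B y /\ B y = zero).
    { apply (op_closed (fun k => Res (x (phi k)))); trivial.
      - intros k; now apply (resolvent_commutes_sqrt mu Res), Hx.
      - apply (filterlim_locally_ball_norm (U := X)); intros eps.
        generalize (Hinv eps); apply filter_imp; intros k Hk.
        unfold ball_norm; rewrite (minus_zero_r (G := X)).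
        eapply Rle_lt_trans; [apply HBy | exact Hk]. }
    now apply op_injective. }
  rewrite E0 in Hy.
  assert (Hmu := Rabs_pos mu).
  (* This radius makes [|mu <Res x, x>| <= 1/4]; together with [<B Res x, B x> <= 1/4] it
     contradicts the identity for [1] at a single index. *)
  assert (Hd : 0 < / (4 * (Rabs mu + 1))) by (apply Rinv_0_lt_compat; lra).
  apply (filterlim_locally_ball_norm (U := X)) with (eps := mkposreal _ Hd)
    in Hy.
  destruct Hy as [n1 Hn1].
  assert (Hq : 0 < / 4) by lra.
  destruct (Hinv (mkposreal _ Hq)) as [n2 Hn2]; simpl in *.
  set (k := max n1 n2).
  specialize (Hn1 k ltac:(lia)); specialize (Hn2 k ltac:(lia)).
  unfold ball_norm in Hn1; rewrite (minus_zero_r (G := X)) in Hn1.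
  destruct (Hx (phi k)) as (Dx & Nx & _).
  destruct HR as (_ & Hr & Hl).
  destruct (Hr (x (phi k))) as [DR ER].
  destruct (op_dom_of_sqrt _ DR) as (D1 & D2 & EA).
  assert (E := f_equal (fun v => inner v (x (phi k))) ER); cbv beta in E.
  rewrite inner_minus_l inner_scal_l EA op_symmetric // inner_norm Nx in E.
  assert (I1 := inner_le (B (Res (x (phi k)))) (B (x (phi k)))).
  assert (I2 := Rabs_inner_le (Res (x (phi k))) (x (phi k))).
  rewrite Nx Rmult_1_r in I2.
  specialize (HBx k); specialize (HBy k).
  assert (P1 := norm_ge_0 (V := X) (B (Res (x (phi k))))).
  assert (P2 := norm_ge_0 (V := X) (B (x (phi k)))).
  assert (Hk1 : / (INR k + 1) <= 1).
  { rewrite -Rinv_1; apply Rinv_le_contravar; generalize (pos_INR k); lra. }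
  assert (I3 : - mu * inner (Res (x (phi k))) (x (phi k)) <= / 4).
  { eapply Rle_trans; [apply Rle_abs | ].
    rewrite Rabs_mult Rabs_Ropp.
    apply Rle_trans with ((Rabs mu + 1) * / (4 * (Rabs mu + 1))).
    - apply Rmult_le_compat; try apply Rabs_pos; lra.
    - right; field; lra. }
  nra.
Qed.

End SquareRoot.

(** Convergence of sequences with steps of ratio 1/3 is what the gliding-hump construction consumes,
    and it can be checked component by component in [D(B) x X]. *)
Definition geometrically_complete (V : NormedModule R_AbsRing) : Prop :=
  forall (x : nat -> V) (C : R),
    (forall n, norm (minus (x (S n)) (x n)) <= C * (1 / 3) ^ n) ->
    exists y, filterlim x eventually (locally y).

Lemma geometric_dist {V : NormedModule R_AbsRing} (x : nat -> V) (C : R) :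
  (forall n, norm (minus (x (S n)) (x n)) <= C * (1 / 3) ^ n) ->
  forall n k, norm (minus (x (n + k)%nat) (x n)) <= 3 / 2 * C * (1 / 3) ^ n.
Proof.
  intros Hx n k.
  assert (HC : 0 <= C).
  { generalize (Hx 0%nat) (norm_ge_0 (minus (x 1%nat) (x 0%nat))); simpl; lra. }
  (* The right-hand side is the exact geometric sum; this stronger form carries the induction. *)
  assert (H : norm (minus (x (n + k)%nat) (x n))
              <= 3 / 2 * C * ((1 / 3) ^ n - (1 / 3) ^ (n + k))).
  { induction k as [ | k IH].
    - rewrite Nat.add_0_r norm_minus_self; lra.
    - rewrite Nat.add_succ_r.
      eapply Rle_trans; [apply (norm_minus_triangle _ (x (n + k)%nat)) | ].
      specialize (Hx (n + k)%nat); simpl; lra. }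
  assert (Hp : 0 < (1 / 3) ^ (n + k)) by (apply pow_lt; lra).
  nra.
Qed.

Lemma pow_third_lim (C : R) (eps : posreal) :
  eventually (fun n => C * (1 / 3) ^ n < eps).
Proof.
  assert (L : is_lim_seq (fun n => C * (1 / 3) ^ n) (C * 0)).
  { apply (is_lim_seq_scal_l _ C 0), is_lim_seq_geom.
    rewrite Rabs_pos_eq; lra. }
  rewrite Rmult_0_r in L; apply is_lim_seq_spec in L.
  destruct (L eps) as [n0 Hn0]; exists n0; intros n Hn.
  specialize (Hn0 n Hn); rewrite Rminus_0_r in Hn0.
  eapply Rle_lt_trans; [apply Rle_abs | exact Hn0].
Qed.

Lemma complete_geometrically_complete (V : CompleteNormedModule R_AbsRing) :
  geometrically_complete V.
Proof.
  intros x C Hx.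
  apply (filterlim_locally_cauchy (U := V) (F := eventually)); intros eps.
  destruct (pow_third_lim (3 * C) eps) as [n0 Hn0].
  exists (fun n => (n0 <= n)%nat); split; [now exists n0 | ].
  intros p q Hp Hq.
  apply (norm_compat1 (V := V)).
  assert (Hd : forall m, (n0 <= m)%nat ->
             norm (minus (x m) (x n0)) <= 3 / 2 * C * (1 / 3) ^ n0).
  { intros m Hm; replace m with (n0 + (m - n0))%nat by lia.
    now apply geometric_dist. }
  eapply Rle_lt_trans; [apply (norm_minus_triangle (V := V) _ (x n0)) | ].
  rewrite (norm_minus_sym (V := V) (x n0)).
  eapply Rle_lt_trans;
    [apply Rplus_le_compat; [exact (Hd q Hq) | exact (Hd p Hp)] | ].
  generalize (Hn0 n0 (Nat.le_refl _)); lra.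
Qed.

(** The norm of [D(B)] sees only [B u]. Coercivity makes the components [u_n] themselves converge in
    [X], and closedness of [B] identifies the limit of [B u_n]. *)
Lemma energy_space_complete {X : HilbertSpace} (A B : pos_self_adjoint X) :
  is_sqrt_op A B -> compact_resolvent A ->
  geometrically_complete (energy_space B).
Proof.
  intros hAB hA z C Hz.
  destruct (sqrt_coercive B A hAB hA) as (K & HK & Hcoer).
  assert (HB : forall n, norm (minus (B (proj1_sig (fst (z (S n)))))
                                (B (proj1_sig (fst (z n)))))
                         <= C * (1 / 3) ^ n).
  { intros n; rewrite -ds_norm_minus.
    eapply Rle_trans; [ | apply Hz].
    apply (norm_fst_le (U := ds_NormedModule B) (V := X)
             (minus (z (S n)) (z n))). }
  destruct (complete_geometrically_complete X _ _ HB) as [a Ha].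
  destruct (complete_geometrically_complete X
              (fun n => proj1_sig (fst (z n))) (K * C)) as [u Hu].
  { intros n; eapply Rle_trans; [apply Hcoer | ].
    - exact (proj2_sig (minus (fst (z (S n))) (fst (z n)))).
    - rewrite op_minus; try apply proj2_sig.
      rewrite Rmult_assoc; apply Rmult_le_compat_l; [lra | apply HB]. }
  destruct (complete_geometrically_complete X (fun n => snd (z n)) C)
    as [v Hv].
  { intros n; eapply Rle_trans; [ | apply Hz].
    apply (norm_snd_le (U := ds_NormedModule B) (V := X)
             (minus (z (S n)) (z n))). }
  destruct (op_closed B _ u a (fun n => proj2_sig (fst (z n))) Hu Ha)
    as [Du Eu].
  exists (exist _ u Du, v).
  apply (filterlim_locally_ball_norm (U := energy_space B)); intros eps.
  assert (He : 0 < eps / 2) by (generalize (cond_pos eps); lra).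
  apply (filterlim_locally_ball_norm (U := X)) with (eps := mkposreal _ He)
    in Ha.
  apply (filterlim_locally_ball_norm (U := X)) with (eps := mkposreal _ He)
    in Hv.
  generalize (filter_and _ _ Ha Hv); apply filter_imp.
  intros n [H1 H2]; unfold ball_norm in *; simpl in H1, H2.
  eapply Rle_lt_trans; [apply norm_prod_le | ].
  assert (H3 : norm (fst (minus (z n) (exist _ u Du, v))) < eps / 2).
  { change (ds_norm B (minus (fst (z n)) (exist _ u Du)) < eps / 2).
    rewrite ds_norm_minus; simpl; now rewrite Eu. }
  replace (pos eps) with (eps / 2 + eps / 2) by field.
  exact (Rplus_lt_compat _ _ _ _ H3 H2).
Qed.

(** * Uniform boundedness *)

Lemma norm_plus_minus_ge {V : NormedModule R_AbsRing} (x y : V) :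
  2 * norm y <= norm (plus x y) + norm (minus x y).
Proof.
  assert (E : minus (plus x y) (minus x y) = scal (2 : R_AbsRing) y).
  { replace (2 : R_AbsRing) with (plus (one : R_AbsRing) (one : R_AbsRing))
      by (unfold plus, one; simpl; ring).
    rewrite scal_distr_r !scal_one /minus opp_plus opp_opp.
    rewrite -plus_assoc (plus_comm (opp x) y) (plus_assoc y y).
    now rewrite (plus_comm _ (opp x)) (plus_assoc x (opp x)) plus_opp_r
      plus_zero_l. }
  assert (H := norm_triangle (plus x y) (opp (minus x y))).
  change (plus (plus x y) (opp (minus x y)))
    with (minus (plus x y) (minus x y)) in H.
  rewrite E norm_opp norm_scal_Rabs in H.
  rewrite (Rabs_pos_eq 2) in H; lra.
Qed.

(** [N] is the operator norm, a supremum over the unit ball that need not be attained. Any fraction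
    above one half could replace [3 / 4] in the gliding-hump argument. *)
Lemma linear_near_max {U V : NormedModule R_AbsRing} (l : U -> V) :
  is_linear l ->
  exists (N : R) (xi : U), norm xi <= 1 /\ 3 / 4 * N <= norm (l xi) /\
    forall x, norm (l x) <= N * norm x.
Proof.
  intros Hl; destruct (linear_norm l Hl) as (M & HM & HlM).
  set (E := fun r => exists x, norm x <= 1 /\ r = norm (l x)).
  destruct (completeness E) as (N & Hub & Hlub).
  - exists M; intros r (x & Hx & ->).
    eapply Rle_trans; [apply HlM | ]; nra.
  - exists 0, zero; rewrite (linear_zero l Hl) !norm_zero; split; lra.
  - assert (HN : 0 <= N).
    { apply Hub; exists zero; rewrite (linear_zero l Hl) !norm_zero.
      split; lra. }
    assert (Hxi : exists xi, norm xi <= 1 /\ 3 / 4 * N <= norm (l xi)).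
    { apply NNPP; intros Nxi.
      assert (N0 : N = 0 \/ N <= 3 / 4 * N).
      { right; apply Hlub; intros r (x & Hx & ->).
        apply Rnot_lt_le; intros Hlt; apply Nxi; exists x; split; lra. }
      apply Nxi; exists zero; rewrite (linear_zero l Hl) !norm_zero.
      split; lra. }
    destruct Hxi as (xi & H1 & H2).
    exists N, xi; repeat split; trivial.
    intros x; destruct (Req_dec (norm x) 0) as [Ex | Nx].
    { rewrite (norm_eq_zero x Ex) (linear_zero l Hl) !norm_zero; lra. }
    assert (Hx : 0 < norm x) by (generalize (norm_ge_0 x); lra).
    assert (Ei : Rabs (/ norm x) = / norm x)
      by (apply Rabs_pos_eq, Rlt_le, Rinv_0_lt_compat, Hx).
    assert (Hs : norm (l (scal (/ norm x) x)) <= N).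
    { apply Hub; exists (scal (/ norm x) x); split; trivial.
      rewrite norm_scal_Rabs Ei; right; field; lra. }
    rewrite (linear_scal l Hl) norm_scal_Rabs Ei in Hs.
    apply Rmult_le_reg_l with (/ norm x); [now apply Rinv_0_lt_compat | ].
    replace (/ norm x * (N * norm x)) with N by (field; lra).
    exact Hs.
Qed.

Lemma geometric_dist_lim {V : NormedModule R_AbsRing} (x : nat -> V) (C : R)
    (y : V) :
  (forall n, norm (minus (x (S n)) (x n)) <= C * (1 / 3) ^ n) ->
  filterlim x eventually (locally y) ->
  forall n, norm (minus y (x n)) <= 3 / 2 * C * (1 / 3) ^ n.
Proof.
  intros Hx Hy n.
  apply Rle_plus_epsilon; intros eps Heps.
  apply (filterlim_locally_ball_norm (F := eventually))
    with (eps := mkposreal eps Heps) in Hy.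
  destruct Hy as [n0 Hn0].
  specialize (Hn0 (n + n0)%nat ltac:(lia)); unfold ball_norm in Hn0.
  eapply Rle_trans; [apply (norm_minus_triangle _ (x (n + n0)%nat)) | ].
  rewrite norm_minus_sym.
  generalize (geometric_dist x C Hx n n0); simpl in Hn0; lra.
Qed.

(* The gliding-hump argument of A. Sokal, "A really simple elementary proof of
   the uniform boundedness theorem": one of [l (x + r xi)], [l (x - r xi)] has
   norm at least [r |l xi|], and steps [r = 3^-k] leave half of this gain in
   the limit, while the operator norms grow like [4^k]. *)
Lemma uniform_boundedness {U V : NormedModule R_AbsRing}
    (hU : geometrically_complete U) (l : nat -> U -> V) :
  (forall n, is_linear (l n)) ->
  (forall x, exists K, forall n, norm (l n x) <= K) ->
  exists M, forall n x, norm (l n x) <= M * norm x.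
Proof.
  intros Hl Hb; apply NNPP; intros Nb.
  assert (Hk : forall k : nat, exists p : nat * R * U,
             4 ^ k <= snd (fst p) /\ norm (snd p) <= 1 /\
             3 / 4 * snd (fst p) <= norm (l (fst (fst p)) (snd p)) /\
             forall x, norm (l (fst (fst p)) x) <= snd (fst p) * norm x).
  { intros k; apply NNPP; intros Nk; apply Nb.
    exists (4 ^ k); intros n x.
    apply Rnot_lt_le; intros Hlt; apply Nk.
    destruct (linear_near_max (l n) (Hl n)) as (N & xi & H1 & H2 & H3).
    exists (n, N, xi); simpl; repeat split; trivial.
    apply Rnot_lt_le; intros HN.
    specialize (H3 x); assert (Hx := norm_ge_0 x); nra. }
  set (p := fun k => proj1_sig (constructive_indefinite_description _ (Hk k))).
  assert (Hp : forall k,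
             4 ^ k <= snd (fst (p k)) /\ norm (snd (p k)) <= 1 /\
             3 / 4 * snd (fst (p k))
               <= norm (l (fst (fst (p k))) (snd (p k))) /\
             forall x, norm (l (fst (fst (p k))) x)
                       <= snd (fst (p k)) * norm x).
  { intros k.
    apply (proj2_sig (constructive_indefinite_description _ (Hk k))). }
  clearbody p; clear Hk Nb.
  set (L := fun k => l (fst (fst (p k)))).
  set (N := fun k => snd (fst (p k))).
  set (step := fun k => scal ((1 / 3) ^ k : R_AbsRing) (snd (p k))).
  set (x := nat_rect (fun _ => U) zero (fun k y =>
              match Rle_dec (norm (L k (step k)))
                      (norm (L k (plus y (step k)))) with
              | left _ => plus y (step k)
              | right _ => minus y (step k)
              end)).
  assert (Hr : forall k, 0 < (1 / 3) ^ k) by (intros k; apply pow_lt; lra).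
  assert (HL : forall k, is_linear (L k)) by (intros k; apply Hl).
  assert (Hstep : forall k, norm (step k) <= (1 / 3) ^ k).
  { intros k; unfold step; rewrite norm_scal_Rabs.
    rewrite Rabs_pos_eq; [ | apply Rlt_le, Hr].
    generalize (Hr k) (proj1 (proj2 (Hp k))); nra. }
  assert (HLstep : forall k, 3 / 4 * N k * (1 / 3) ^ k <= norm (L k (step k))).
  { intros k; unfold step; rewrite (linear_scal _ (HL k)) norm_scal_Rabs.
    rewrite Rabs_pos_eq; [ | apply Rlt_le, Hr].
    rewrite Rmult_comm; apply Rmult_le_compat_l; [apply Rlt_le, Hr | ].
    apply Hp. }
  assert (HLx : forall k, norm (L k (step k)) <= norm (L k (x (S k)))).
  { intros k; simpl; destruct Rle_dec as [ | Hn]; trivial.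
    apply Rnot_le_lt in Hn.
    generalize (norm_plus_minus_ge (L k (x k)) (L k (step k))).
    rewrite -(linear_plus _ (HL k)) -(linear_minus (L k) _ _ (HL k)); lra. }
  assert (Hx : forall k, norm (minus (x (S k)) (x k)) <= 1 * (1 / 3) ^ k).
  { intros k; rewrite Rmult_1_l; simpl; destruct Rle_dec.
    - replace (minus (plus (x k) (step k)) (x k)) with (step k); trivial.
      unfold minus.
      now rewrite (plus_comm (x k)) -plus_assoc plus_opp_r plus_zero_r.
    - replace (minus (minus (x k) (step k)) (x k)) with (opp (step k)).
      + now rewrite norm_opp.
      + unfold minus.
        now rewrite (plus_comm (x k)) -plus_assoc plus_opp_r plus_zero_r. }
  destruct (hU x 1 Hx) as [y Hy].
  destruct (Hb y) as [K HK].
  (* The steps after the [k]-th move the point by at most [3/2 * 3^-(k+1) = 1/2 * 3^-k], which costs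
     half of [N k * 3^-k] out of the three quarters gained. The remaining quarter, with
     [N k >= 4^k], grows like [(4/3)^k]. *)
  assert (Hgrow : forall k, (1 + 1 / 3) ^ k <= 4 * K).
  { intros k.
    assert (H1 := HK (fst (fst (p k)))); fold (L k) in H1.
    assert (H2 := geometric_dist_lim x 1 y Hx Hy (S k)).
    assert (H3 : norm (L k (minus y (x (S k))))
                 <= N k * norm (minus y (x (S k)))) by apply Hp.
    assert (H4 : norm (L k (x (S k)))
                 <= norm (L k y) + norm (L k (minus y (x (S k))))).
    { rewrite (linear_minus (L k) _ _ (HL k)).
      rewrite -(norm_opp (minus (L k y) _)) opp_minus.
      eapply Rle_trans; [ | apply norm_triangle].
      right; f_equal; unfold minus.
      rewrite plus_comm -plus_assoc plus_opp_l.
      now rewrite plus_zero_r. }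
    assert (HN : 4 ^ k <= N k) by apply Hp.
    assert (H5 : norm (minus y (x (S k))) <= 1 / 2 * (1 / 3) ^ k)
      by (rewrite -tech_pow_Rmult in H2; lra).
    specialize (HLx k); specialize (HLstep k); specialize (Hr k).
    assert (HN0 : 0 < 4 ^ k) by (apply pow_lt; lra).
    assert (H6 : N k * norm (minus y (x (S k)))
                 <= N k * (1 / 2 * (1 / 3) ^ k))
      by (apply Rmult_le_compat_l; lra).
    assert (H7 : N k * (1 / 3) ^ k <= 4 * K) by lra.
    replace (1 + 1 / 3) with (4 * (1 / 3)) by field.
    rewrite Rpow_mult_distr; nra. }
  (* Bernoulli: [(1 + 1/3)^k >= 1 + k/3 > 4 K] once [k > 12 K]. *)
  destruct (INR_unbounded (12 * K)) as [k Hk].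
  specialize (Hgrow k).
  assert (H13 : 0 < 1 / 3) by lra.
  generalize (poly k (1 / 3) H13); lra.
Qed.

(** If no bound exists, there are [t_n -> 0] and [x_n] with [|S t_n x_n| > (n + 1) |x_n|]. Strong
    continuity makes [S t_n x] converge for each [x], hence stay bounded, against uniform
    boundedness. *)
Lemma semigroup_locally_bounded {V : NormedModule R_AbsRing}
    (hV : geometrically_complete V) (S : R -> V -> V) :
  C0_semigroup S ->
  exists M d, 0 < M /\ 0 < d /\
    forall t x, 0 <= t <= d -> norm (S t x) <= M * norm x.
Proof.
  intros (Hlin & H0 & _ & Hc); apply NNPP; intros Nb.
  assert (Hn : forall n : nat, exists p : R * V,
             0 <= fst p <= / (INR n + 1) /\
             (INR n + 1) * norm (snd p) < norm (S (fst p) (snd p))).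
  { intros n; apply NNPP; intros Nn; apply Nb.
    assert (Hn := pos_INR n).
    exists (INR n + 1), (/ (INR n + 1)); repeat split; [lra | | ].
    { apply Rinv_0_lt_compat; lra. }
    intros t x Ht; apply Rnot_lt_le; intros Hlt; apply Nn.
    now exists (t, x). }
  set (p := fun k => proj1_sig (constructive_indefinite_description _ (Hn k))).
  assert (Hp : forall n, 0 <= fst (p n) <= / (INR n + 1) /\
             (INR n + 1) * norm (snd (p n)) < norm (S (fst (p n)) (snd (p n)))).
  { intros k.
    apply (proj2_sig (constructive_indefinite_description _ (Hn k))). }
  clearbody p; clear Hn Nb.
  destruct (uniform_boundedness hV (fun n => S (fst (p n)))) as [M HM].
  - intros n; apply Hlin, Hp.
  - intros x.
    destruct (filterlim_bounded (fun n => S (fst (p n)) x)) as [K HK];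
      [ | now exists K].
    exists x.
    apply (filterlim_locally_ball_norm (F := eventually)); intros eps.
    destruct (proj1 (filterlim_locally_ball_norm (F := at_right 0) _ _)
                (Hc x) eps) as [d Hd].
    destruct (INR_unbounded (/ d)) as [n0 Hn0].
    exists n0; intros n Hn.
    (* [at_right 0] excludes [0], so the case [t_n = 0] is settled by [S 0 z = z]. *)
    destruct (proj1 (proj1 (Hp n))) as [Hpos | <-].
    + apply Hd; trivial.
      apply (norm_compat1 (V := R_NormedModule)).
      change (Rabs (fst (p n) - 0) < d).
      rewrite Rminus_0_r Rabs_pos_eq; [ | lra].
      eapply Rle_lt_trans; [apply Hp | ].
      rewrite -(Rinv_inv d); apply le_INR in Hn.
      assert (Hd' := Rinv_0_lt_compat _ (cond_pos d)).
      apply Rinv_lt_contravar; [nra | lra].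
    + unfold ball_norm; rewrite H0 norm_minus_self; apply cond_pos.
  - destruct (INR_unbounded M) as [n Hn].
    specialize (HM n (snd (p n))); simpl in HM.
    generalize (proj2 (Hp n)) (norm_ge_0 (snd (p n))); nra.
Qed.

(** * Time integrals of mild solutions *)

Lemma minus_minus_swap {G : AbelianGroup} (a b c d : G) :
  minus (minus a b) (minus c d) = minus (minus a c) (minus b d).
Proof.
  unfold minus; rewrite !opp_plus !opp_opp -!plus_assoc; f_equal.
  now rewrite !plus_assoc (plus_comm (opp b)).
Qed.

Lemma minus_minus_cancel {G : AbelianGroup} (u x y : G) :
  minus (minus u x) (minus u y) = minus y x.
Proof.
  rewrite minus_minus_swap minus_eq_zero; unfold minus at 1.
  now rewrite plus_zero_l opp_minus.
Qed.

Lemma filterlim_minus {T : Type} {V : NormedModule R_AbsRing}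
    (F : (T -> Prop) -> Prop) {FF : Filter F} (f g : T -> V) (x y : V) :
  filterlim f F (locally x) -> filterlim g F (locally y) ->
  filterlim (fun t => minus (f t) (g t)) F (locally (minus x y)).
Proof.
  intros Hf Hg; unfold minus.
  eapply filterlim_comp_2; [exact Hf | | apply (filterlim_plus x (opp y))].
  exact (filterlim_comp _ _ _ g opp _ _ _ Hg (filterlim_opp y)).
Qed.

Lemma norm_scal_inv_minus {V : NormedModule R_AbsRing} (h : R) (x y : V) :
  0 < h -> norm (minus (scal (/ h) x) y) = / h * norm (minus x (scal h y)).
Proof.
  intros Hh.
  transitivity (norm (scal (/ h) (minus x (scal h y)))).
  - rewrite scal_minus_distr_l scal_assoc.
    change (mult (/ h) h) with (/ h * h).
    rewrite Rinv_l; [ | lra].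
    now rewrite (scal_one (K := R_AbsRing)).
  - rewrite norm_scal_Rabs Rabs_pos_eq //.
    now apply Rlt_le, Rinv_0_lt_compat.
Qed.

Section MildIntegral.

Context {V : NormedModule R_AbsRing} (S : R -> V -> V) (hS : C0_semigroup S)
  (M d : R) (hM : 0 < M) (hd : 0 < d)
  (hMd : forall t x, 0 <= t <= d -> norm (S t x) <= M * norm x).

Lemma semigroup_uniform_on_net (x : nat -> V) (eps : R) (n : nat) :
  0 < eps ->
  exists del, 0 < del /\ forall k t, (k <= n)%nat -> 0 <= t <= del ->
    norm (minus (S t (x k)) (x k)) < eps.
Proof.
  intros Heps; destruct hS as (_ & H0 & _ & Hc).
  assert (H : forall k, exists del, 0 < del /\ forall t, 0 <= t <= del ->
                norm (minus (S t (x k)) (x k)) < eps).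
  { intros k.
    destruct (proj1 (filterlim_locally_ball_norm (F := at_right 0) _ _)
                (Hc (x k)) (mkposreal eps Heps)) as [e He].
    exists (e / 2); split; [apply is_pos_div_2 | intros t [[Ht | <-] Ht']].
    - apply He; trivial.
      apply (norm_compat1 (V := R_NormedModule)).
      change (Rabs (t - 0) < e).
      rewrite Rminus_0_r Rabs_pos_eq; generalize (cond_pos e); lra.
    - now rewrite H0 norm_minus_self. }
  induction n as [ | n (d1 & Hd1 & IH)].
  - destruct (H 0%nat) as (e & He & Ht); exists e; split; trivial.
    intros k t Hk; replace k with 0%nat by lia; apply Ht.
  - destruct (H (Datatypes.S n)) as (e & He & Ht).
    exists (Rmin d1 e); split; [now apply Rmin_pos | intros k t Hk Htm].
    assert (H1 := Rmin_l d1 e); assert (H2 := Rmin_r d1 e).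
    destruct (Nat.eq_dec k (Datatypes.S n)) as [-> | Nk].
    + apply Ht; lra.
    + apply IH; [lia | lra].
Qed.

(** A net [g (x k)] of the compact orbit splits the difference into [S t (g s - g x_k)],
    [S t (g x_k) - g x_k] and [g x_k - g r]. The local bound [M] handles the first piece, strong
    continuity at finitely many vectors the second. *)
Lemma semigroup_uniform_on_compact (g : R -> V) (a b eps : R) :
  (forall t, continuous g t) -> a <= b -> 0 < eps ->
  exists del, 0 < del /\ forall r t s, a <= r <= b -> 0 <= t <= del ->
    r <= s <= r + del -> norm (minus (S t (g s)) (g r)) <= eps.
Proof.
  intros Hg Hab Heps.
  (* The three pieces contribute [M e], [e] and [e]. *)
  assert (He : 0 < eps / (M + 2)) by (apply Rdiv_lt_0_compat; lra).
  set (e := mkposreal _ He).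
  (* [s] may exceed [b] by [del <= 1]. Mesh [eta / 2] and [del <= eta / 2] keep [s] within [eta] of
     the net point just below [r]. *)
  destruct (unifcont_normed_1d g a (b + 1) (fun x _ => Hg x) e) as [eta Heta].
  assert (Heta0 := cond_pos eta).
  set (x := fun k => a + INR k * (eta / 2)).
  destruct (nfloor_ex ((b - a) / (eta / 2))) as [n [_ Hn]].
  { apply Rmult_le_pos; [lra | apply Rlt_le, Rinv_0_lt_compat; lra]. }
  destruct (semigroup_uniform_on_net (fun k => g (x k)) e n (cond_pos e))
    as (d1 & Hd1 & Hnet).
  set (del := Rmin (Rmin d1 d) (Rmin 1 (eta / 2))).
  assert (Hdel1 : del <= d1) by (eapply Rle_trans; apply Rmin_l).
  assert (Hdel2 : del <= d)
    by (eapply Rle_trans; [apply Rmin_l | apply Rmin_r]).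
  assert (Hdel3 : del <= 1)
    by (eapply Rle_trans; [apply Rmin_r | apply Rmin_l]).
  assert (Hdel4 : del <= eta / 2) by (eapply Rle_trans; apply Rmin_r).
  exists del; split.
  { repeat apply Rmin_pos; lra. }
  intros r t s Hr Ht Hs.
  destruct (nfloor_ex ((r - a) / (eta / 2))) as [k [Hk1 Hk2]].
  { apply Rmult_le_pos; [lra | apply Rlt_le, Rinv_0_lt_compat; lra]. }
  assert (Er : r - a = (r - a) / (eta / 2) * (eta / 2)) by (field; lra).
  assert (Eb : b - a = (b - a) / (eta / 2) * (eta / 2)) by (field; lra).
  assert (Hkr : x k <= r < x k + eta / 2).
  { unfold x; split; nra. }
  assert (Hkn : (k <= n)%nat).
  { apply Nat.nlt_ge; intros Hnk.
    apply le_INR in Hnk; rewrite S_INR in Hnk; nra. }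
  assert (Hak : a <= x k).
  { unfold x; generalize (pos_INR k); nra. }
  assert (Hb : forall y, x k <= y < x k + eta -> y <= b + 1 ->
             norm (minus (g y) (g (x k))) < e).
  { intros y Hy Hyb; apply (Heta (x k) y); try lra.
    apply (norm_compat1 (V := R_NormedModule)).
    change (Rabs (y - x k) < eta); rewrite Rabs_pos_eq; lra. }
  destruct hS as (Hlin & _).
  eapply Rle_trans; [apply (norm_minus_triangle _ (S t (g (x k)))) | ].
  rewrite -(linear_minus (S t)); [ | apply Hlin; lra].
  assert (H1 := hMd t (minus (g s) (g (x k))) ltac:(lra)).
  assert (H2 := norm_minus_triangle (S t (g (x k))) (g (x k)) (g r)).
  rewrite (norm_minus_sym (g (x k))) in H2.
  assert (H3 := Hb s ltac:(lra) ltac:(lra)).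
  assert (H4 := Hb r ltac:(lra) ltac:(lra)).
  assert (H5 := Hnet k t Hkn ltac:(lra)); cbv beta in H5.
  replace eps with (M * e + e + e) by (simpl; field; lra).
  generalize (norm_ge_0 (minus (g s) (g (x k)))); nra.
Qed.

Context (F : V -> V) (z : R -> V) (hz : mild_solution S F z)
  (P Q : R -> V) (zc : forall t, continuous z t)
  (Fc : forall t, continuous (fun s => F (z s)) t)
  (hP : forall a b, is_RInt z a b (minus (P b) (P a)))
  (hQ : forall a b, is_RInt (fun s => F (z s)) a b (minus (Q b) (Q a))).

Lemma is_RInt_mild_shift (a b h : R) : 0 <= h ->
  is_RInt (fun r => minus (z (r + h)) (S h (z r))) a b
    (minus (minus (P (b + h)) (P (a + h))) (S h (minus (P b) (P a)))).
Proof.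
  intros Hh.
  apply (is_RInt_minus (V := V)).
  - apply (is_RInt_ext (fun r => scal 1 (z (1 * r + h)))).
    + intros r _; rewrite Rmult_1_l; apply (scal_one (K := R_AbsRing)).
    + apply is_RInt_comp_lin; rewrite !Rmult_1_l; apply hP.
  - apply is_RInt_linear; [ | apply hP]; destruct hS as (Hl & _); now apply Hl.
Qed.

(** Variation of constants over [[r, r + h]], where the Duhamel integrand is nearly the constant
    [F (z r)]. *)
Lemma mild_step (r h : R) (eps : R) : 0 < h ->
  (forall s, r <= s <= r + h ->
     norm (minus (S (r + h - s) (F (z s))) (F (z r))) <= eps) ->
  norm (minus (minus (z (r + h)) (S h (z r))) (scal h (F (z r)))) <= h * eps.
Proof.
  intros Hh Hs.
  destruct (hz r (r + h) ltac:(lra)) as (I & HI & E).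
  replace (r + h - r) with h in E by ring.
  assert (E1 : minus (z (r + h)) (S h (z r)) = I).
  { rewrite E /minus plus_comm plus_assoc plus_opp_l; apply plus_zero_l. }
  rewrite E1.
  apply (norm_RInt_le
           (fun s => minus (S (r + h - s) (F (z s))) (F (z r)))
           (fun _ => eps) r (r + h)); trivial; [lra | | ].
  - apply (is_RInt_minus (V := V)); trivial.
    replace h with (r + h - r) at 2 by ring.
    apply (is_RInt_const (V := V)).
  - replace (h * eps) with ((r + h - r) * eps) by ring.
    apply (is_RInt_const (V := R_NormedModule)).
Qed.

(** With [p] the integral of [z] over [[a, b]], [S h p - p] is the integral over the shifted
    interval minus [p], minus [E h]. The first difference reduces to two end windows and yields
    [z b - z a]. [E h] integrates the defect [z (r + h) - S h (z r)], which is [h F (z r)] up to an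
    error uniform in [r]. *)
Lemma mild_integral_generator (a b : R) : a <= b ->
  filterlim
    (fun h => scal (/ h) (minus (S h (minus (P b) (P a))) (minus (P b) (P a))))
    (at_right 0)
    (locally (minus (minus (z b) (z a)) (minus (Q b) (Q a)))).
Proof.
  intros Hab.
  set (E := fun h => minus (minus (P (b + h)) (P (a + h)))
                       (S h (minus (P b) (P a)))).
  apply (filterlim_ext (fun h =>
    minus (minus (scal (/ h) (minus (P (b + h)) (P b)))
                 (scal (/ h) (minus (P (a + h)) (P a))))
          (scal (/ h) (E h)))).
  { intros h; rewrite -!scal_minus_distr_l; f_equal.
    rewrite (minus_minus_swap (P (b + h))).
    apply minus_minus_cancel. }
  assert (Hder : forall c, filterlim
            (fun h => scal (/ h) (minus (P (c + h)) (P c)))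
            (at_right 0) (locally (z c))).
  { intros c; apply (filterlim_locally_ball_norm (F := at_right 0)).
    intros eps.
    assert (He : 0 < eps / 2) by (generalize (cond_pos eps); lra).
    destruct (proj1 (filterlim_locally_ball_norm (F := locally c) _ _)
                (zc c) (mkposreal _ He)) as [e Hc].
    exists e; intros h Hh Hpos.
    change (Rabs (h - 0) < e) in Hh.
    rewrite Rminus_0_r Rabs_pos_eq in Hh; [ | lra].
    unfold ball_norm in *; simpl in Hc.
    rewrite norm_scal_inv_minus //.
    apply Rle_lt_trans with (/ h * (h * (eps / 2))).
    2: { replace (/ h * (h * (eps / 2))) with (eps / 2) by (field; lra).
         generalize (cond_pos eps); lra. }
    apply Rmult_le_compat_l; [now apply Rlt_le, Rinv_0_lt_compat | ].
    apply (norm_RInt_le (fun s => minus (z s) (z c))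
             (fun _ => eps / 2) c (c + h)); [lra | | | ].
    - intros s Hs; apply Rlt_le, Hc.
      apply (norm_compat1 (V := R_NormedModule)).
      change (Rabs (s - c) < e); rewrite Rabs_pos_eq; lra.
    - apply (is_RInt_minus (V := V)); [apply hP | ].
      replace h with (c + h - c) at 2 by ring.
      apply (is_RInt_const (V := V)).
    - replace (h * (eps / 2)) with ((c + h - c) * (eps / 2)) by ring.
      apply (is_RInt_const (V := R_NormedModule)). }
  assert (HE : filterlim (fun h => scal (/ h) (E h)) (at_right 0)
                 (locally (minus (Q b) (Q a)))).
  { apply (filterlim_locally_ball_norm (F := at_right 0)).
    intros eps.
    assert (He : 0 < eps / (b - a + 1))
      by (apply Rdiv_lt_0_compat; [apply cond_pos | lra]).
    destruct (semigroup_uniform_on_compact _ a b _ Fc Hab He)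
      as (del & Hdel & Hu).
    exists (mkposreal _ Hdel); intros h Hh Hpos.
    change (Rabs (h - 0) < del) in Hh.
    rewrite Rminus_0_r Rabs_pos_eq in Hh; [ | lra].
    unfold ball_norm.
    rewrite norm_scal_inv_minus //.
    set (c := eps / (b - a + 1)) in *.
    apply Rle_lt_trans with (/ h * ((b - a) * (h * c))).
    2: { replace (/ h * ((b - a) * (h * c))) with ((b - a) * c)
           by (field; lra).
         replace (pos eps) with ((b - a + 1) * c)
           by (unfold c; field; lra).
         lra. }
    apply Rmult_le_compat_l; [now apply Rlt_le, Rinv_0_lt_compat | ].
    apply (norm_RInt_le
             (fun r => minus (minus (z (r + h)) (S h (z r)))
                         (scal h (F (z r))))
             (fun _ => h * c) a b); [lra | | | ].
    - intros r Hr; apply mild_step; trivial.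
      intros s Hs; apply Hu; lra.
    - apply (is_RInt_minus (V := V)).
      + apply is_RInt_mild_shift; lra.
      + apply (is_RInt_scal (V := V)), hQ.
    - apply (is_RInt_const (V := R_NormedModule)). }
  apply filterlim_minus; [apply _ | | exact HE].
  apply filterlim_minus; [apply _ | |]; apply Hder.
Qed.

End MildIntegral.

(** * The energy estimate *)

Lemma is_RInt_continuous (f : R -> R) (a b : R) :
  (forall t, continuous f t) -> is_RInt f a b (RInt f a b).
Proof.
  intros Hf; apply (RInt_correct (V := R_CompleteNormedModule)).
  apply (ex_RInt_continuous (V := R_CompleteNormedModule)); auto.
Qed.

Lemma RInt_nonneg (f : R -> R) (a b : R) :
  a <= b -> (forall t, continuous f t) -> (forall t, 0 <= f t) ->
  0 <= RInt f a b.
Proof.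
  intros Hab Hf Hp; apply RInt_ge_0; trivial.
  now eexists; apply is_RInt_continuous.
Qed.

Lemma RInt_subinterval (f : R -> R) (a s t b : R) :
  a <= s -> s <= t -> t <= b -> (forall r, continuous f r) ->
  (forall r, 0 <= f r) -> RInt f s t <= RInt f a b.
Proof.
  intros Has Hst Htb Hf Hp.
  assert (E : RInt f a b = RInt f a s + (RInt f s t + RInt f t b)).
  { apply (is_RInt_unique (V := R_CompleteNormedModule)).
    apply (is_RInt_Chasles (V := R_NormedModule)) with s;
      [now apply is_RInt_continuous | ].
    apply (is_RInt_Chasles (V := R_NormedModule)) with t;
      now apply is_RInt_continuous. }
  generalize (RInt_nonneg f a s Has Hf Hp) (RInt_nonneg f t b Htb Hf Hp); lra.
Qed.

Section EnergyEstimate.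

Context {X : HilbertSpace}.

Lemma is_derive_continuous (f : R -> X) (t : R) (df : X) :
  is_derive f t df -> continuous f t.
Proof.
  intros H; apply (ex_derive_continuous (K := R_AbsRing) (V := X)).
  now exists df.
Qed.

Lemma inner_young_halves (k : R) (x y : X) : 0 < k ->
  inner x y <= k / 2 * inner x x + / (2 * k) * inner y y.
Proof.
  intros Hk; generalize (inner_young k x y Hk); rewrite -!inner_norm.
  intros H; replace (/ (2 * k) * inner y y) with (inner y y / k / 2)
    by (field; lra).
  lra.
Qed.

(** * A Poincare inequality for mean-zero curves *)

Section Poincare.

Context (Y Y1 : R -> X) (T : R) (hT : 0 < T)
  (hY : forall t, is_derive Y t (Y1 t)) (hY1 : forall t, continuous Y1 t).

(** Cauchy-Schwarz for the increment [e]: [|e|^2] is the integral of [<Y1, e>], and Young with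
    weight [T] lets half of [|e|^2] be absorbed. *)
Lemma sqr_increment_le (s t : R) : 0 <= s -> s <= t -> t <= T ->
  inner (minus (Y t) (Y s)) (minus (Y t) (Y s))
  <= T * RInt (fun r => inner (Y1 r) (Y1 r)) 0 T.
Proof.
  intros Hs Hst Ht; set (e := minus (Y t) (Y s)).
  pose (q := fun r : R => inner (Y1 r) (Y1 r)).
  change (inner e e <= T * RInt q 0 T).
  assert (Hc : forall r, continuous q r)
    by (intros r; now apply continuous_inner).
  assert (H1 : is_RInt (fun r => inner (Y1 r) e) s t
                 (minus (inner (Y t) e) (inner (Y s) e))).
  { apply (is_RInt_derive (V := R_CompleteNormedModule)
             (fun r => inner (Y r) e)).
    - intros r _.
      replace (inner (Y1 r) e) with (inner (Y1 r) e + inner (Y r) zero)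
        by (rewrite inner_zero_r; ring).
      apply (is_derive_inner Y (fun _ => e)); [apply hY | ].
      apply (is_derive_const (K := R_AbsRing) (V := X)).
    - intros r _; apply continuous_inner; trivial; apply continuous_const. }
  assert (H2 := RInt_subinterval _ 0 s t T Hs Hst Ht Hc
                  (fun r => inner_self_ge_0 (Y1 r))).
  assert (H3 : minus (inner (Y t) e) (inner (Y s) e)
    <= T / 2 * RInt q s t
       + (t - s) * (/ (2 * T) * inner e e)).
  { apply (is_RInt_le (fun r => inner (Y1 r) e)
             (fun r => T / 2 * inner (Y1 r) (Y1 r) + / (2 * T) * inner e e)
             s t); trivial.
    - apply (is_RInt_plus (V := R_NormedModule)).
      + apply (is_RInt_scal (V := R_NormedModule)).
        now apply is_RInt_continuous.
      + apply (is_RInt_const (V := R_NormedModule)).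
    - intros r _; now apply inner_young_halves. }
  change (minus (inner (Y t) e) (inner (Y s) e))
    with (inner (Y t) e - inner (Y s) e) in H3.
  rewrite -inner_minus_l in H3; fold e in H3.
  assert (H4 := inner_self_ge_0 e).
  assert (H5 : (t - s) * (/ (2 * T) * inner e e) <= / 2 * inner e e).
  { replace (/ 2 * inner e e) with (T * (/ (2 * T) * inner e e))
      by (field; lra).
    apply Rmult_le_compat_r; [ | lra].
    apply Rmult_le_pos; trivial; apply Rlt_le, Rinv_0_lt_compat; lra. }
  apply (Rmult_le_compat_l (T / 2)) in H2; [ | lra].
  lra.
Qed.

(** Averaging [<Y t - Y s, Y t>] over [s] gives [|Y t|^2] because the mean is zero, so the increment
    bound becomes the supremum bound [T * D], which is integrated. Testing the mean against vectors
    keeps all integrals scalar. *)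
Lemma poincare :
  (forall e, RInt (fun t => inner (Y t) e) 0 T = 0) ->
  RInt (fun t => inner (Y t) (Y t)) 0 T
  <= T ^ 2 * RInt (fun t => inner (Y1 t) (Y1 t)) 0 T.
Proof.
  intros Hm; set (D := RInt (fun t => inner (Y1 t) (Y1 t)) 0 T).
  assert (Yc : forall t, continuous Y t)
    by (intros t; apply (is_derive_continuous _ _ _ (hY t))).
  assert (Hsup : forall t, 0 < t < T -> inner (Y t) (Y t) <= T * D).
  { intros t Ht.
    assert (Hinc : forall s, 0 < s < T ->
      inner (minus (Y t) (Y s)) (minus (Y t) (Y s)) <= T * D).
    { intros s Hs; destruct (Rle_dec s t).
      - apply sqr_increment_le; lra.
      - rewrite inner_norm (norm_minus_sym (V := X)) -inner_norm.
        apply sqr_increment_le; lra. }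
    assert (H : (T - 0) * inner (Y t) (Y t) - 0
                <= (T - 0) * (/ 2 * (T * D) + / 2 * inner (Y t) (Y t))).
    { apply (is_RInt_le
               (fun s => inner (Y t) (Y t) - inner (Y s) (Y t))
               (fun s => / 2 * (T * D) + / 2 * inner (Y t) (Y t)) 0 T).
      - lra.
      - apply (is_RInt_minus (V := R_NormedModule)).
        + apply (is_RInt_const (V := R_NormedModule)).
        + assert (Hi : is_RInt (fun s => inner (Y s) (Y t)) 0 T
                         (RInt (fun s => inner (Y s) (Y t)) 0 T)).
          { apply is_RInt_continuous; intros s.
            apply continuous_inner; trivial; apply continuous_const. }
          rewrite Hm in Hi; exact Hi.
      - apply (is_RInt_const (V := R_NormedModule)).
      - intros s Hs; rewrite -inner_minus_l.
        assert (H1 := inner_young_halves 1 (minus (Y t) (Y s)) (Y t) Rlt_0_1).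
        specialize (Hinc s Hs); lra. }
    nra. }
  replace (T ^ 2 * D) with ((T - 0) * (T * D)) by ring.
  apply (is_RInt_le (fun t => inner (Y t) (Y t)) (fun _ => T * D) 0 T).
  - lra.
  - apply is_RInt_continuous; intros t; now apply continuous_inner.
  - apply (is_RInt_const (V := R_NormedModule)).
  - exact Hsup.
Qed.

End Poincare.

(* Testing the equation with [W1] bounds [int |BW1|^2], testing it with [W]
   bounds [int |W1|^2] by [int |BW|^2] and [int <Gam, W>]; the Poincare
   inequality closes the estimate because [T L] and [T / alpha] are small. *)
Lemma energy_estimate (W W1 W2 BW BW1 Gam : R -> X) (alpha L T : R) :
  0 < alpha -> 0 < L -> 0 < T -> T * L <= 1 / 5 -> T <= 3 / 10 * alpha ->
  (forall t, is_derive W t (W1 t)) -> (forall t, is_derive W1 t (W2 t)) ->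
  (forall t, is_derive BW t (BW1 t)) ->
  (forall t, continuous W2 t) -> (forall t, continuous BW1 t) ->
  (forall t, continuous Gam t) ->
  W T = W 0 -> W1 T = W1 0 -> BW T = BW 0 ->
  (forall e, RInt (fun t => inner (W t) e) 0 T = 0) ->
  (forall e, RInt (fun t => inner (BW t) e) 0 T = 0) ->
  (forall t, inner (W2 t) (W1 t) + alpha * inner (BW1 t) (BW1 t)
             + inner (BW1 t) (BW t) = inner (Gam t) (W1 t)) ->
  (forall t, inner (W2 t) (W t) + alpha * inner (BW1 t) (BW t)
             + inner (BW t) (BW t) = inner (Gam t) (W t)) ->
  RInt (fun t => inner (BW t) (BW t) + inner (W1 t) (W1 t)) 0 T
  <= / (5 * L ^ 2) * RInt (fun t => inner (Gam t) (Gam t)) 0 T.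
Proof.
  intros Ha HL HT HTL HTa dW dW1 dBW cW2 cBW1 cG pW pW1 pBW mW mBW E1 E2.
  assert (cW : forall t, continuous W t)
    by (intros t; apply (is_derive_continuous _ _ _ (dW t))).
  assert (cW1 : forall t, continuous W1 t)
    by (intros t; apply (is_derive_continuous _ _ _ (dW1 t))).
  assert (cBW : forall t, continuous BW t)
    by (intros t; apply (is_derive_continuous _ _ _ (dBW t))).
  assert (HI : forall f : R -> X, (forall t, continuous f t) ->
            is_RInt (fun t => inner (f t) (f t)) 0 T
              (RInt (fun t => inner (f t) (f t)) 0 T)).
  { intros f Hf; apply is_RInt_continuous; intros t.
    now apply continuous_inner. }
  assert (Hpos : forall f : R -> X, (forall t, continuous f t) ->
            0 <= RInt (fun t => inner (f t) (f t)) 0 T).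
  { intros f Hf; apply RInt_nonneg; [lra | | intros; apply inner_self_ge_0].
    intros t; now apply continuous_inner. }
  assert (Hflux : forall f f1 g g1 : R -> X,
            (forall t, is_derive f t (f1 t)) ->
            (forall t, is_derive g t (g1 t)) ->
            (forall t, continuous f1 t) -> (forall t, continuous g1 t) ->
            f T = f 0 -> g T = g 0 ->
            is_RInt (fun t => inner (f1 t) (g t) + inner (f t) (g1 t)) 0 T 0).
  { intros f f1 g g1 df dg cf1 cg1 pf pg.
    replace 0 with (minus (inner (f T) (g T)) (inner (f 0) (g 0))) at 2
      by (rewrite pf pg; apply (minus_eq_zero (G := R_AbelianGroup))).
    apply (is_RInt_derive (V := R_CompleteNormedModule)
             (fun t => inner (f t) (g t))); intros t _.
    - apply is_derive_inner; trivial.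
    - apply (continuous_plus (V := R_NormedModule)); apply continuous_inner;
        trivial; eapply is_derive_continuous; [apply dg | apply df]. }
  pose (D := RInt (fun t => inner (BW1 t) (BW1 t)) 0 T : R).
  pose (P := RInt (fun t => inner (W1 t) (W1 t)) 0 T : R).
  pose (Q := RInt (fun t => inner (BW t) (BW t)) 0 T : R).
  pose (N := RInt (fun t => inner (Gam t) (Gam t)) 0 T : R).
  pose (Z := RInt (fun t => inner (W t) (W t)) 0 T : R).
  (* The zeros are the period integrals of the derivatives of [|W1|^2] and [|BW|^2], left
     unsimplified to match [is_RInt_plus]. *)
  assert (I1 : alpha * D + / 2 * (0 + 0) <= / (2 * L) * N + L / 2 * P).
  { apply (is_RInt_le
      (fun t => alpha * inner (BW1 t) (BW1 t)
         + / 2 * ((inner (W2 t) (W1 t) + inner (W1 t) (W2 t))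
                  + (inner (BW1 t) (BW t) + inner (BW t) (BW1 t))))
      (fun t => / (2 * L) * inner (Gam t) (Gam t)
                + L / 2 * inner (W1 t) (W1 t)) 0 T).
    - lra.
    - apply (is_RInt_plus (V := R_NormedModule));
        apply (is_RInt_scal (V := R_NormedModule)); [now apply HI | ].
      apply (is_RInt_plus (V := R_NormedModule)); now apply Hflux.
    - apply (is_RInt_plus (V := R_NormedModule));
        apply (is_RInt_scal (V := R_NormedModule)); now apply HI.
    - intros t _.
      assert (H := inner_young_halves L (W1 t) (Gam t) HL).
      rewrite (inner_sym _ (W1 t) (W2 t)) (inner_sym _ (BW t) (BW1 t)).
      rewrite inner_sym -E1 in H; lra. }
  (* [|W1|^2] is the derivative of [<W1, W>] minus [<W2, W>], and the equation tested with [W]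
     replaces the latter. Young with weight [T / L] gives [Z] the coefficient [L / (2 T)], which
     Poincare turns into [T L / 2] on [P]. *)
  assert (I2 : P <= (0 + alpha / 2 * 0)
                    + (Q + (T / (2 * L) * N + L / (2 * T) * Z))).
  { apply (is_RInt_le
      (fun t => inner (W1 t) (W1 t))
      (fun t => (inner (W2 t) (W t) + inner (W1 t) (W1 t)
                 + alpha / 2 * (inner (BW1 t) (BW t) + inner (BW t) (BW1 t)))
         + (inner (BW t) (BW t)
            + (T / (2 * L) * inner (Gam t) (Gam t)
               + L / (2 * T) * inner (W t) (W t)))) 0 T).
    - lra.
    - now apply HI.
    - apply (is_RInt_plus (V := R_NormedModule)).
      + apply (is_RInt_plus (V := R_NormedModule)); [now apply Hflux | ].
        apply (is_RInt_scal (V := R_NormedModule)); now apply Hflux.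
      + apply (is_RInt_plus (V := R_NormedModule)); [now apply HI | ].
        apply (is_RInt_plus (V := R_NormedModule));
          apply (is_RInt_scal (V := R_NormedModule)); now apply HI.
    - intros t _.
      assert (Hk : 0 < T / L) by now apply Rdiv_lt_0_compat.
      assert (H := inner_young_halves (T / L) (opp (Gam t)) (W t) Hk).
      rewrite !inner_opp_l inner_opp_r -E2 in H.
      replace (T / L / 2) with (T / (2 * L)) in H by (field; lra).
      replace (/ (2 * (T / L))) with (L / (2 * T)) in H by (field; lra).
      rewrite (inner_sym _ (BW t) (BW1 t)); lra. }
  assert (I3 : Q <= T ^ 2 * D) by now apply poincare.
  assert (I4 : Z <= T ^ 2 * P) by now apply poincare.
  assert (HD : 0 <= D) by now apply Hpos.
  assert (HP : 0 <= P) by now apply Hpos.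
  assert (HN : 0 <= N) by now apply Hpos.
  change (RInt (fun t => inner (Gam t) (Gam t)) 0 T) with N.
  replace (RInt (fun t => inner (BW t) (BW t) + inner (W1 t) (W1 t)) 0 T)
    with (Q + P).
  2: { symmetry; apply (is_RInt_unique (V := R_CompleteNormedModule)).
       apply (is_RInt_plus (V := R_NormedModule)); now apply HI. }
  clearbody D P Q N Z.
  set (x := N / L ^ 2).
  assert (EN : N = x * L ^ 2) by (unfold x; field; lra).
  assert (Hx : 0 <= x).
  { apply Rmult_le_pos; trivial; apply Rlt_le, Rinv_0_lt_compat; nra. }
  clearbody x; rewrite EN in I1, I2 |- *.
  replace (/ (2 * L) * (x * L ^ 2)) with (L * x / 2) in I1 by (field; lra).
  replace (T / (2 * L) * (x * L ^ 2)) with (T * L * x / 2) in I2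
    by (field; lra).
  replace (/ (5 * L ^ 2) * (x * L ^ 2)) with (x / 5) by (field; lra).
  assert (I5 : L / (2 * T) * Z <= T * L * P / 2).
  { replace (T * L * P / 2) with (L / (2 * T) * (T ^ 2 * P)) by (field; lra).
    apply Rmult_le_compat_l; trivial.
    apply Rlt_le, Rdiv_lt_0_compat; lra. }
  assert (I6 : T ^ 2 * D <= 3 / 100 * (x + P)).
  { apply Rle_trans with (T * (3 / 10 * (alpha * D))).
    { replace (T ^ 2 * D) with (T * D * T) by ring.
      replace (T * (3 / 10 * (alpha * D)))
        with (T * D * (3 / 10 * alpha)) by ring.
      apply Rmult_le_compat_l; [nra | lra]. }
    apply Rle_trans with (T * (3 / 10 * (L * x / 2 + L / 2 * P))).
    { apply Rmult_le_compat_l; lra. }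
    replace (T * (3 / 10 * (L * x / 2 + L / 2 * P)))
      with (T * L * (3 / 20 * (x + P))) by field.
    nra. }
  (* Now [Q <= 3/100 (x + P)] and [P <= Q + x/10 + P/10], so [P <= 13/87 x] and [Q + P <= x / 5]. *)
  nra.
Qed.

End EnergyEstimate.

(** * Differences of periodic functions *)

Lemma zero_of_RInt_zero (f : R -> R) (T c : R) :
  0 < c < T -> (forall t, continuous f t) -> (forall t, 0 <= f t) ->
  RInt f 0 T <= 0 -> f c = 0.
Proof.
  intros Hc Hf Hp HI.
  destruct (Rle_lt_or_eq_dec _ _ (Hp c)) as [Hlt | ]; [exfalso | easy].
  assert (He : 0 < f c / 2) by lra.
  destruct (proj1 (filterlim_locally_ball_norm (F := locally c) _ _)
              (Hf c) (mkposreal _ He)) as [d Hd].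
  set (e := Rmin (d / 2) (T - c)).
  assert (Hd0 := cond_pos d).
  assert (He0 : 0 < e) by (apply Rmin_pos; lra).
  assert (He1 : e <= d / 2) by apply Rmin_l.
  assert (He2 : e <= T - c) by apply Rmin_r.
  assert (H1 := RInt_subinterval f 0 c (c + e) T ltac:(lra) ltac:(lra)
                  ltac:(lra) Hf Hp).
  assert (H2 : (c + e - c) * (f c / 2) <= RInt f c (c + e)).
  { apply (is_RInt_le (fun _ => f c / 2) f c (c + e)); [lra | | | ].
    - apply (is_RInt_const (V := R_NormedModule)).
    - now apply is_RInt_continuous.
    - intros r Hr.
      assert (H : ball c d r).
      { apply (norm_compat1 (V := R_NormedModule)).
        change (Rabs (r - c) < d); rewrite Rabs_pos_eq; lra. }
      specialize (Hd r H).
      change (Rabs (f r - f c) < f c / 2) in Hd.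
      apply Rabs_def2 in Hd; lra. }
  nra.
Qed.

(** * Increments of a curve and of its primitive *)

Section Differences.

Context {V : CompleteNormedModule R_AbsRing}.

Definition diff (h : R) (g : R -> V) (t : R) : V := minus (g (t + h)) (g t).

Definition primitive0 (g : R -> V) (t : R) : V := RInt g 0 t.

Lemma is_RInt_primitive0 (g : R -> V) (a b : R) :
  (forall t, continuous g t) ->
  is_RInt g a b (minus (primitive0 g b) (primitive0 g a)).
Proof.
  intros Hg.
  assert (H : forall c d, is_RInt g c d (RInt g c d)).
  { intros c d; apply (RInt_correct (V := V)).
    apply (ex_RInt_continuous (V := V)); auto. }
  unfold minus; rewrite plus_comm.
  apply (is_RInt_Chasles (V := V)) with 0; [ | apply H].
  apply (is_RInt_swap (V := V)), H.
Qed.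

Lemma is_derive_primitive0 (g : R -> V) (t : R) :
  (forall t, continuous g t) -> is_derive (primitive0 g) t (g t).
Proof.
  intros Hg; apply (is_derive_RInt (V := V) g _ 0); trivial.
  apply filter_forall; intros b; apply (RInt_correct (V := V)).
  apply (ex_RInt_continuous (V := V)); auto.
Qed.

(** A primitive of a periodic function may drift by a fixed amount over each period; its increment
    over length [h] is a window integral and does not. *)
Lemma diff_primitive_periodic (g : R -> V) (h T t : R) :
  (forall t, continuous g t) -> (forall t, g (t + T) = g t) ->
  diff h (primitive0 g) (t + T) = diff h (primitive0 g) t.
Proof.
  intros Hg HT.
  assert (H : is_RInt g t (t + h)
                (minus (primitive0 g (t + T + h)) (primitive0 g (t + T)))).
  { apply (is_RInt_ext (fun r => scal 1 (g (1 * r + T)))).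
    - intros r _; rewrite Rmult_1_l HT; apply (scal_one (K := R_AbsRing)).
    - apply (is_RInt_comp_lin (V := V)); rewrite !Rmult_1_l.
      replace (t + h + T) with (t + T + h) by ring.
      now apply is_RInt_primitive0. }
  apply (is_RInt_unique (V := V)) in H; unfold diff at 1; rewrite -H.
  apply (is_RInt_unique (V := V)), is_RInt_primitive0, Hg.
Qed.

Lemma diff_periodic (g : R -> V) (h T t : R) :
  (forall t, g (t + T) = g t) -> diff h g (t + T) = diff h g t.
Proof.
  intros HT; unfold diff; rewrite HT; f_equal.
  rewrite -(HT (t + h)); f_equal; ring.
Qed.

Lemma continuous_shift (g : R -> V) (h t : R) :
  (forall t, continuous g t) -> continuous (fun s => g (s + h)) t.
Proof.
  intros Hg; apply (continuous_comp (fun s => s + h) g); trivial.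
  apply (continuous_plus (V := R_NormedModule));
    [apply continuous_id | apply continuous_const].
Qed.

Lemma continuous_diff (g : R -> V) (h t : R) :
  (forall t, continuous g t) -> continuous (diff h g) t.
Proof.
  intros Hg; apply (continuous_minus (V := V)); trivial.
  now apply continuous_shift.
Qed.

Lemma is_derive_diff (g g1 : R -> V) (h t : R) :
  (forall t, is_derive g t (g1 t)) -> is_derive (diff h g) t (diff h g1 t).
Proof.
  intros Hg; apply (is_derive_minus (V := V)); trivial.
  replace (g1 (t + h)) with (scal (1 : R_AbsRing) (g1 (t + h)))
    by exact (scal_one (K := R_AbsRing) (V := V) _).
  apply (is_derive_comp (V := V) g (fun s => s + h)); trivial.
  auto_derive; trivial.
Qed.

Lemma diff_approx (G g : R -> V) (h eps t : R) : 0 < h ->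
  is_RInt g t (t + h) (minus (G (t + h)) (G t)) ->
  (forall r, t <= r <= t + h -> norm (minus (g r) (g t)) <= eps) ->
  norm (minus (diff h G t) (scal h (g t))) <= h * eps.
Proof.
  intros Hh HG Hg.
  apply (norm_RInt_le (fun r => minus (g r) (g t)) (fun _ => eps) t (t + h));
    [lra | trivial | | ].
  - apply (is_RInt_minus (V := V)); [exact HG | ].
    replace h with (t + h - t) at 2 by ring.
    apply (is_RInt_const (V := V)).
  - replace (h * eps) with ((t + h - t) * eps) by ring.
    apply (is_RInt_const (V := R_NormedModule)).
Qed.

(** The outer increment uses the window approximation at [t + s] and at [t], each with error
    [h * eps]. *)
Lemma diff_diff_approx (G g : R -> V) (s h eps t : R) : 0 < h ->
  (forall a b, is_RInt g a b (minus (G b) (G a))) ->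
  (forall r, t <= r <= t + h -> norm (minus (g r) (g t)) <= eps) ->
  (forall r, t + s <= r <= t + s + h ->
     norm (minus (g r) (g (t + s))) <= eps) ->
  norm (minus (diff s (diff h G) t) (scal h (diff s g t))) <= h * (2 * eps).
Proof.
  intros Hh HG H1 H2.
  assert (A1 := diff_approx G g h eps t Hh (HG _ _) H1).
  assert (A2 := diff_approx G g h eps (t + s) Hh (HG _ _) H2).
  assert (E : minus (diff s (diff h G) t) (scal h (diff s g t))
    = minus (minus (diff h G (t + s)) (scal h (g (t + s))))
            (minus (diff h G t) (scal h (g t)))).
  { rewrite (minus_minus_swap (G := V)); unfold diff at 1 3.
    f_equal; exact (scal_minus_distr_l (V := V) h _ _). }
  rewrite E; eapply Rle_trans; [apply (norm_triangle (V := V)) | ].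
  rewrite (norm_opp (V := V)).
  replace (h * (2 * eps)) with (h * eps + h * eps) by ring.
  exact (Rplus_le_compat _ _ _ _ A2 A1).
Qed.

End Differences.

(** This supplies the mean-zero hypothesis of [poincare]: over a full period a translate has the
    same integral. *)
Lemma RInt_diff_periodic {X : HilbertSpace} (g : R -> X) (s T : R) (e : X) :
  (forall t, continuous g t) -> (forall t, g (t + T) = g t) ->
  RInt (fun t => inner (diff s g t) e) 0 T = 0.
Proof.
  intros Hg HT.
  pose (c := fun t => inner (g t) e : R_CompleteNormedModule).
  assert (Hc : forall t, continuous c t).
  { intros t; apply continuous_inner; trivial; apply continuous_const. }
  assert (HcT : forall t, c (t + T) = c t)
    by (intros t; unfold c; now rewrite HT).
  assert (H1 := is_RInt_primitive0 c 0 T Hc).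
  assert (H2 : is_RInt (fun r => c (r + s)) 0 T
                 (minus (primitive0 c (T + s)) (primitive0 c (0 + s)))).
  { apply (is_RInt_ext (fun r => scal 1 (c (1 * r + s)))).
    - intros r _; rewrite Rmult_1_l.
      apply (scal_one (K := R_AbsRing) (V := R_NormedModule)).
    - apply (is_RInt_comp_lin (V := R_NormedModule)); rewrite !Rmult_1_l.
      now apply (is_RInt_primitive0 (V := R_CompleteNormedModule)). }
  (* Equality of the integrals over [[T, T + s]] and [[0, s]] is, rearranged, equality of those over
     [[s, T + s]] and [[0, T]]. *)
  assert (E := diff_primitive_periodic c s T 0 Hc HcT).
  unfold diff in E; rewrite Rplus_0_l in E.
  apply (is_RInt_unique (V := R_CompleteNormedModule)).
  apply (is_RInt_ext (fun t => minus (c (t + s)) (c t))).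
  { intros t _; unfold diff; rewrite inner_minus_l; reflexivity. }
  replace 0 with
    (minus (minus (primitive0 c (T + s)) (primitive0 c (0 + s)))
           (minus (primitive0 c T) (primitive0 c 0))) at 2.
  - apply (is_RInt_minus (V := R_NormedModule)); [exact H2 | exact H1].
  - rewrite (minus_minus_swap (G := R_AbelianGroup)) E Rplus_0_l.
    apply (minus_eq_zero (G := R_AbelianGroup)).
Qed.

(** From [1 / sqrt 2 >= 7/10] follow [p >= 17/10 (1 + 2 / (alpha L))] and [sqrt p >= 13/10];
    expanding [(1 + sqrt p)^2] gives [53/10 + 34 / (10 alpha L)] as a lower bound. Its two summands
    separately yield [T L < 10/53] and [T < 10/34 alpha]. *)
Lemma period_bound_smallness (alpha L T : R) :
  0 < alpha -> 0 < L -> 0 < T ->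
  T < 1 / (L * (1 + sqrt ((1 + 1 / sqrt 2) * (1 + 2 / (alpha * L)))) ^ 2) ->
  T * L <= 1 / 5 /\ T <= 3 / 10 * alpha.
Proof.
  intros Ha HL HT H.
  assert (HaL : 0 < 2 / (alpha * L)) by (apply Rdiv_lt_0_compat; nra).
  assert (S2 : 0 < sqrt 2) by (apply sqrt_lt_R0; lra).
  assert (S2' : sqrt 2 <= 10 / 7).
  { rewrite -(sqrt_Rsqr (10 / 7)); [ | lra].
    apply sqrt_le_1_alt; unfold Rsqr; lra. }
  assert (Hi : 7 / 10 <= 1 / sqrt 2).
  { apply Rmult_le_reg_r with (sqrt 2); trivial.
    replace (1 / sqrt 2 * sqrt 2) with 1 by (field; lra); lra. }
  set (p := (1 + 1 / sqrt 2) * (1 + 2 / (alpha * L))) in *.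
  assert (Hp : 17 / 10 + 17 / 10 * (2 / (alpha * L)) <= p)
    by (unfold p; nra).
  assert (Hs : 13 / 10 <= sqrt p).
  { rewrite -(sqrt_Rsqr (13 / 10)); [ | lra].
    apply sqrt_le_1_alt; unfold Rsqr; lra. }
  assert (Hq : 53 / 10 + 34 / (10 * (alpha * L)) <= (1 + sqrt p) ^ 2).
  { assert (E : sqrt p ^ 2 = p) by (apply pow2_sqrt; lra).
    replace (34 / (10 * (alpha * L))) with (17 / 10 * (2 / (alpha * L)))
      by (field; lra).
    lra. }
  set (q := (1 + sqrt p) ^ 2) in *.
  assert (H34 : 0 < 34 / (10 * (alpha * L)))
    by (apply Rdiv_lt_0_compat; nra).
  assert (HTq : T * L * q < 1).
  { apply Rmult_lt_reg_r with (/ (L * q)); [apply Rinv_0_lt_compat; nra | ].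
    replace (T * L * q * / (L * q)) with T by (field; split; nra).
    lra. }
  assert (HTL : 0 < T * L) by nra.
  split; [nra | ].
  assert (H5 : T * L * (34 / (10 * (alpha * L))) < 1) by nra.
  replace (T * L * (34 / (10 * (alpha * L)))) with (T / alpha * (34 / 10)) in H5
    by (field; lra).
  replace T with (T / alpha * alpha) by (field; lra).
  apply Rmult_le_compat_r; lra.
Qed.

(** * The periodic solution *)

Section PeriodicSolution.

Context (X : HilbertSpace) (A B : pos_self_adjoint X)
  (hA : compact_resolvent A) (hAB : is_sqrt_op A B)
  (alpha : R) (halpha : 0 < alpha)
  (S : R -> energy_space B -> energy_space B) (hS : C0_semigroup S)
  (hSA : is_generator (damped_wave_op A B alpha) S)
  (f : domain_space B -> X -> X) (L : R) (hL : 0 < L)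
  (hf : forall (u1 u2 : domain_space B) (v1 v2 : X),
      norm (minus (f u1 v1) (f u2 v2))
      <= L * sqrt (norm (minus u1 u2) ^ 2 + norm (minus v1 v2) ^ 2))
  (z : R -> energy_space B)
  (zd : forall t, is_derive (fun s => proj1_sig (fst (z s)) : X) t (snd (z t)))
  (zc : forall t, continuous z t)
  (zm : mild_solution S (fun y => (zero, f (fst y) (snd y))) z).

Definition sol_u (t : R) : X := proj1_sig (fst (z t)).
Definition sol_v (t : R) : X := snd (z t).
Definition sol_Bu (t : R) : X := B (sol_u t).
Definition sol_f (t : R) : X := f (fst (z t)) (snd (z t)).

Lemma sol_f_lipschitz (s t : R) :
  norm (minus (sol_f s) (sol_f t)) <= L * norm (minus (z s) (z t)).
Proof. apply hf. Qed.

Lemma sol_Bu_le (s t : R) :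
  norm (minus (sol_Bu s) (sol_Bu t)) <= norm (minus (z s) (z t)).
Proof.
  unfold sol_Bu, sol_u; rewrite -ds_norm_minus.
  apply (norm_fst_le (U := ds_NormedModule B) (V := X) (minus (z s) (z t))).
Qed.

Lemma sol_v_le (s t : R) :
  norm (minus (sol_v s) (sol_v t)) <= norm (minus (z s) (z t)).
Proof.
  apply (norm_snd_le (U := ds_NormedModule B) (V := X) (minus (z s) (z t))).
Qed.

Lemma sol_norm_sqr (s t : R) :
  norm (minus (z s) (z t)) ^ 2
  = inner (minus (sol_Bu s) (sol_Bu t)) (minus (sol_Bu s) (sol_Bu t))
    + inner (minus (sol_v s) (sol_v t)) (minus (sol_v s) (sol_v t)).
Proof.
  rewrite !inner_norm /sol_Bu /sol_u -ds_norm_minus.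
  apply (prod_norm_sqr (U := ds_NormedModule B) (V := X)).
Qed.

(** The Lipschitz bound is relative to [z], so one argument covers [sol_f], [sol_Bu] and [sol_v]. *)
Lemma continuous_of_lipschitz (g : R -> X) (K : R) : 0 < K ->
  (forall s t, norm (minus (g s) (g t)) <= K * norm (minus (z s) (z t))) ->
  forall t, continuous g t.
Proof.
  intros HK Hg t.
  apply (filterlim_locally_ball_norm (U := X) (F := locally t)); intros eps.
  assert (He : 0 < eps / K) by (apply Rdiv_lt_0_compat; [apply cond_pos | lra]).
  generalize (proj1 (filterlim_locally_ball_norm (F := locally t) _ _)
                (zc t) (mkposreal _ He)).
  apply filter_imp; intros s Hs; unfold ball_norm in *; simpl in Hs.
  eapply Rle_lt_trans; [apply Hg | ].
  apply (Rmult_lt_compat_l K) in Hs; trivial.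
  replace (K * (eps / K)) with (pos eps) in Hs by (field; lra).
  exact Hs.
Qed.

Lemma continuous_sol_f (t : R) : continuous sol_f t.
Proof. apply (continuous_of_lipschitz _ L hL sol_f_lipschitz). Qed.

Lemma continuous_sol_Bu (t : R) : continuous sol_Bu t.
Proof.
  apply (continuous_of_lipschitz _ 1 Rlt_0_1).
  intros r s; rewrite Rmult_1_l; apply sol_Bu_le.
Qed.

Lemma continuous_sol_v (t : R) : continuous sol_v t.
Proof.
  apply (continuous_of_lipschitz _ 1 Rlt_0_1).
  intros r s; rewrite Rmult_1_l; apply sol_v_le.
Qed.

Lemma continuous_sol_u (t : R) : continuous sol_u t.
Proof. exact (is_derive_continuous _ _ _ (zd t)). Qed.

(** * Primitives along the solution and the time-integrated equation *)

Lemma is_RInt_sol_v (a b : R) :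
  is_RInt sol_v a b (minus (sol_u b) (sol_u a)).
Proof.
  apply (is_RInt_derive (V := X)).
  - intros t _; apply zd.
  - intros t _; apply continuous_sol_v.
Qed.

(** [B] passes through the integral by the adjoint criterion: [<u, B e>] and [<B u, e>] have equal
    integrals for every [e] in [D(B)]. *)
Lemma primitive_sol_u_dom (t : R) :
  op_dom B (primitive0 sol_u t) /\
  B (primitive0 sol_u t) = primitive0 sol_Bu t.
Proof.
  apply op_adjoint; intros e He.
  assert (HI : forall g : R -> X, (forall r, continuous g r) ->
            is_RInt g 0 t (primitive0 g t)).
  { intros g Hg; apply (RInt_correct (V := X)).
    apply (ex_RInt_continuous (V := X)); auto. }
  assert (H1 := is_RInt_linear _ _ _ _ _ (is_linear_inner_l (B e))
                  (HI _ continuous_sol_u)).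
  assert (H2 := is_RInt_linear _ _ _ _ _ (is_linear_inner_l e)
                  (HI _ continuous_sol_Bu)).
  rewrite (inner_sym _ (B e)) (inner_sym _ e).
  apply (is_RInt_unique (V := R_CompleteNormedModule)) in H1.
  apply (is_RInt_unique (V := R_CompleteNormedModule)) in H2.
  rewrite -H1 -H2.
  apply (RInt_ext (V := R_CompleteNormedModule)); intros r _.
  symmetry; apply op_symmetric; [ | exact He].
  exact (proj2_sig (fst (z r))).
Qed.

(** Since [u' = v], the second component of a primitive of [z] can be [sol_u] itself; the generator
    at an increment then involves increments of [u] directly. *)
Definition energy_primitive (t : R) : energy_space B :=
  (exist _ (primitive0 sol_u t) (proj1 (primitive_sol_u_dom t)), sol_u t).

Lemma is_RInt_energy_primitive (a b : R) :
  is_RInt z a b (minus (energy_primitive b) (energy_primitive a)).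
Proof.
  apply (is_RInt_fct_extend_pair (U := ds_NormedModule B) (V := X) z a b
           (minus (fst (energy_primitive b)) (fst (energy_primitive a)))
           (minus (sol_u b) (sol_u a))); [ | apply is_RInt_sol_v].
  apply (is_RInt_linear_isometry (V := X) _ _ _ _ _ (is_linear_ds_embed B)
           (norm_ds_embed B)).
  rewrite (linear_minus _ _ _ (is_linear_ds_embed B)).
  unfold ds_embed; simpl.
  rewrite !(proj2 (primitive_sol_u_dom _)).
  apply is_RInt_primitive0, continuous_sol_Bu.
Qed.

Lemma is_RInt_forcing (a b : R) :
  is_RInt (fun s => (zero, f (fst (z s)) (snd (z s))) : energy_space B) a b
    (minus ((zero, primitive0 sol_f b) : energy_space B)
       (zero, primitive0 sol_f a)).
Proof.
  apply (is_RInt_fct_extend_pair (U := ds_NormedModule B) (V := X) _ a b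
           (minus zero zero) (minus (primitive0 sol_f b) (primitive0 sol_f a))).
  - assert (H := is_RInt_const (V := ds_NormedModule B) a b zero).
    rewrite scal_zero_r in H; rewrite minus_zero_r; exact H.
  - apply is_RInt_primitive0, continuous_sol_f.
Qed.

Lemma continuous_forcing (t : R) :
  continuous (fun s => (zero, f (fst (z s)) (snd (z s))) : energy_space B) t.
Proof.
  apply (filterlim_locally_ball_norm (U := energy_space B) (F := locally t)).
  intros eps.
  generalize (proj1 (filterlim_locally_ball_norm (U := X) (F := locally t) _ _)
                (continuous_sol_f t) eps).
  apply filter_imp; intros s Hs; unfold ball_norm in *.
  eapply Rle_lt_trans; [apply norm_prod_le | ].
  change (norm (minus (zero : ds_NormedModule B) zero)
          + norm (minus (sol_f s) (sol_f t)) < eps).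
  rewrite norm_minus_self Rplus_0_l; exact Hs.
Qed.

(** This is the second component of the generator identity at an increment of [energy_primitive]. It
    places only the combination [q] in the domain of [A]. *)
Lemma integrated_equation (a b : R) : a <= b ->
  let q := plus (scal alpha (minus (sol_u b) (sol_u a)))
             (minus (primitive0 sol_u b) (primitive0 sol_u a)) in
  op_dom A q /\
  minus (minus (sol_v b) (sol_v a))
    (minus (primitive0 sol_f b) (primitive0 sol_f a)) = opp (A q).
Proof.
  intros Hab.
  destruct (semigroup_locally_bounded (energy_space_complete A B hAB hA) S hS)
    as (M & d & HM & Hd & HMd).
  assert (H := mild_integral_generator S hS M d HM Hd HMd _ z zm
                 energy_primitive _ zc continuous_forcing
                 is_RInt_energy_primitive is_RInt_forcing a b Hab).
  apply hSA in H.
  destruct H as (H1 & _ & H2).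
  exact (conj H1 H2).
Qed.

Lemma sol_u_dom (t : R) : op_dom B (sol_u t).
Proof. exact (proj2_sig (fst (z t))). Qed.

(** The two summands of [q] are known to lie in [D(B)] only. Moving one factor [B] of
    [A q = B (B q)] onto [e] allows the sum to be split. *)
Lemma weak_equation (a b : R) (e : X) : a <= b -> op_dom B e ->
  inner (minus (sol_v b) (sol_v a)) e
  + alpha * inner (minus (sol_Bu b) (sol_Bu a)) (B e)
  + inner (minus (primitive0 sol_Bu b) (primitive0 sol_Bu a)) (B e)
  = inner (minus (primitive0 sol_f b) (primitive0 sol_f a)) e.
Proof.
  intros Hab He.
  destruct (integrated_equation a b Hab) as [Dq Eq].
  set (q := plus _ _) in *.
  assert (Du : op_dom B (minus (sol_u b) (sol_u a)))
    by (apply dom_plus; [ | apply dom_opp]; apply sol_u_dom).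
  assert (DP : op_dom B (minus (primitive0 sol_u b) (primitive0 sol_u a)))
    by (apply dom_plus; [ | apply dom_opp]; apply primitive_sol_u_dom).
  destruct (op_dom_of_sqrt B A hAB q Dq) as (_ & DBq & EA).
  assert (H := f_equal (fun x => inner x e) Eq); cbv beta in H.
  rewrite inner_minus_l inner_opp_l EA op_symmetric // in H.
  unfold q in H; rewrite op_plus ?op_scal // in H; [ | now apply dom_scal].
  rewrite !op_minus ?(proj2 (primitive_sol_u_dom _)) in H;
    try apply primitive_sol_u_dom; try apply sol_u_dom.
  rewrite inner_plus_l inner_scal_l in H.
  unfold sol_Bu at 1 2; lra.
Qed.

Lemma diff_diff_dom (s h t : R) (g Bg : R -> X) :
  (forall r, op_dom B (g r) /\ B (g r) = Bg r) ->
  op_dom B (diff s (diff h g) t) /\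
  B (diff s (diff h g) t) = diff s (diff h Bg) t.
Proof.
  intros Hg.
  assert (H1 : forall r, op_dom B (diff h g r)).
  { intros r; apply dom_plus; [ | apply dom_opp]; apply Hg. }
  split.
  - apply dom_plus; [ | apply dom_opp]; apply H1.
  - unfold diff at 1; rewrite op_minus //; unfold diff; rewrite !op_minus;
      try apply Hg.
    now rewrite !(proj2 (Hg _)).
Qed.

Lemma diff_diff_weak_equation (s h t : R) (e Be : X) : 0 < h ->
  op_dom B e /\ B e = Be ->
  inner (diff s (diff h sol_v) t) e
  + alpha * inner (diff s (diff h sol_Bu) t) Be
  + inner (diff s (diff h (primitive0 sol_Bu)) t) Be
  = inner (diff s (diff h (primitive0 sol_f)) t) e.
Proof.
  intros Hh [De <-].
  assert (H1 := weak_equation t (t + h) e ltac:(lra) De).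
  assert (H2 := weak_equation (t + s) (t + s + h) e ltac:(lra) De).
  unfold diff; rewrite !inner_minus_l; rewrite !inner_minus_l in H1, H2; lra.
Qed.

(** * Estimates over one period *)

Context (T : R) (hT : 0 < T) (zT : forall t, z (t + T) = z t)
  (hTL : T * L <= 1 / 5) (hTa : T <= 3 / 10 * alpha).

Lemma diff_diff_estimate (s h : R) : 0 < h ->
  RInt (fun t => inner (diff s (diff h (primitive0 sol_Bu)) t)
                   (diff s (diff h (primitive0 sol_Bu)) t)
                 + inner (diff s (diff h sol_u) t)
                     (diff s (diff h sol_u) t)) 0 T
  <= / (5 * L ^ 2)
     * RInt (fun t => inner (diff s (diff h (primitive0 sol_f)) t)
                        (diff s (diff h (primitive0 sol_f)) t)) 0 T.
Proof.
  intros Hh.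
  assert (pu : forall t, sol_u (t + T) = sol_u t)
    by (intros t; unfold sol_u; now rewrite zT).
  assert (pBu : forall t, sol_Bu (t + T) = sol_Bu t)
    by (intros t; unfold sol_Bu; now rewrite pu).
  assert (du : forall t, is_derive sol_u t (sol_v t)) by exact zd.
  assert (dP : forall t, is_derive (primitive0 sol_u) t (sol_u t))
    by (intros t; apply is_derive_primitive0, continuous_sol_u).
  assert (dPB : forall t, is_derive (primitive0 sol_Bu) t (sol_Bu t))
    by (intros t; apply is_derive_primitive0, continuous_sol_Bu).
  assert (dQ : forall t, is_derive (primitive0 sol_f) t (sol_f t))
    by (intros t; apply is_derive_primitive0, continuous_sol_f).
  assert (ppP : forall t, diff h (primitive0 sol_u) (t + T)
                          = diff h (primitive0 sol_u) t)
    by (intros t; apply diff_primitive_periodic; trivial;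
        apply continuous_sol_u).
  assert (ppPB : forall t, diff h (primitive0 sol_Bu) (t + T)
                           = diff h (primitive0 sol_Bu) t)
    by (intros t; apply diff_primitive_periodic; trivial;
        apply continuous_sol_Bu).
  assert (DW : forall t, op_dom B (diff s (diff h (primitive0 sol_u)) t) /\
            B (diff s (diff h (primitive0 sol_u)) t)
            = diff s (diff h (primitive0 sol_Bu)) t)
    by (intros t; apply diff_diff_dom, primitive_sol_u_dom).
  assert (DW1 : forall t, op_dom B (diff s (diff h sol_u) t) /\
            B (diff s (diff h sol_u) t) = diff s (diff h sol_Bu) t).
  { intros t; apply diff_diff_dom; intros r; split; trivial.
    apply sol_u_dom. }
  assert (per0 : forall g : R -> X, (forall t, g (t + T) = g t) ->
            g T = g 0)
    by (intros g Hg; rewrite -(Hg 0); f_equal; ring).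
  (* [W] is the window integral of the translate difference, up to a constant shift of the window's
     origin none at all; [W] and [W1] take values in [D(B)], which makes them admissible test
     vectors. *)
  apply (energy_estimate (diff s (diff h (primitive0 sol_u)))
           (diff s (diff h sol_u)) (diff s (diff h sol_v))
           (diff s (diff h (primitive0 sol_Bu))) (diff s (diff h sol_Bu))
           (diff s (diff h (primitive0 sol_f))) alpha L T); trivial.
  - intros t; apply is_derive_diff; intros r; now apply is_derive_diff.
  - intros t; apply is_derive_diff; intros r; now apply is_derive_diff.
  - intros t; apply is_derive_diff; intros r; now apply is_derive_diff.
  - intros t; apply continuous_diff; intros r.
    apply continuous_diff, continuous_sol_v.
  - intros t; apply continuous_diff; intros r.
    apply continuous_diff, continuous_sol_Bu.
  - intros t; apply continuous_diff; intros r; apply continuous_diff.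
    intros r'; exact (is_derive_continuous _ _ _ (dQ r')).
  - apply per0; intros t; now apply diff_periodic.
  - apply per0; intros t; apply diff_periodic; intros r.
    now apply diff_periodic.
  - apply per0; intros t; now apply diff_periodic.
  - intros e; apply RInt_diff_periodic; trivial.
    intros t; apply continuous_diff.
    intros r; exact (is_derive_continuous _ _ _ (dP r)).
  - intros e; apply RInt_diff_periodic; trivial.
    intros t; apply continuous_diff.
    intros r; exact (is_derive_continuous _ _ _ (dPB r)).
  - intros t.
    rewrite (inner_sym _ (diff s (diff h sol_Bu) t)
               (diff s (diff h (primitive0 sol_Bu)) t)).
    now apply diff_diff_weak_equation.
  - intros t; now apply diff_diff_weak_equation.
Qed.

Lemma uniform_continuity (s eps : R) : 0 < eps ->
  exists h, 0 < h /\ forall t r, 0 <= t <= T ->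
    (t <= r <= t + h -> norm (minus (z r) (z t)) <= eps) /\
    (t + s <= r <= t + s + h -> norm (minus (z r) (z (t + s))) <= eps).
Proof.
  intros Heps.
  assert (Hs := Rle_abs s); assert (Hs' := Rle_abs (- s)).
  rewrite Rabs_Ropp in Hs'; assert (Hs0 := Rabs_pos s).
  (* For either sign of [s] this interval contains [t] and [t + s] for all [t] in [[0, T]], with
     room 1 for the window. *)
  destruct (unifcont_normed_1d z (- Rabs s) (T + Rabs s + 1)
              (fun x _ => zc x) (mkposreal _ Heps)) as [d Hd].
  assert (Hd0 := cond_pos d).
  set (h := Rmin (d / 2) 1).
  assert (Hh0 : 0 < h) by (apply Rmin_pos; lra).
  assert (Hh1 : h <= d / 2) by apply Rmin_l.
  assert (Hh2 : h <= 1) by apply Rmin_r.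
  assert (H : forall t r, - Rabs s <= t <= T + Rabs s -> t <= r <= t + h ->
            norm (minus (z r) (z t)) <= eps).
  { intros t r Ht Hr; apply Rlt_le, (Hd t r); try lra.
    apply (norm_compat1 (V := R_NormedModule)).
    change (Rabs (r - t) < d); rewrite Rabs_pos_eq; lra. }
  exists h; split; trivial; intros t r Ht; split; intros Hr; apply H; lra.
Qed.

Lemma sqr_norm_near (x y : X) (c : R) :
  norm (minus x y) <= c -> norm x ^ 2 <= 2 * norm y ^ 2 + 2 * c ^ 2.
Proof.
  intros H; assert (H0 := norm_ge_0 (V := X) (minus x y)).
  assert (E : x = plus (minus x y) y)
    by (apply inner_ext; intros e; rewrite inner_plus_l inner_minus_l; ring).
  rewrite {1}E; assert (H1 := norm_plus_sqr_le (minus x y) y).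
  assert (H2 : norm (minus x y) ^ 2 <= c ^ 2) by (apply pow_incr; split; lra).
  eapply Rle_trans; [exact H1 | ].
  rewrite Rplus_comm; apply Rplus_le_compat_l.
  apply Rmult_le_compat_l; [lra | exact H2].
Qed.

Definition increment (s t : R) : R := norm (minus (z (t + s)) (z t)) ^ 2.

Lemma incrementE (s t : R) :
  increment s t = inner (diff s sol_Bu t) (diff s sol_Bu t)
                  + inner (diff s sol_v t) (diff s sol_v t).
Proof. apply sol_norm_sqr. Qed.

Lemma continuous_increment (s t : R) : continuous (increment s) t.
Proof.
  apply (continuous_ext (fun t =>
    inner (diff s sol_Bu t) (diff s sol_Bu t)
    + inner (diff s sol_v t) (diff s sol_v t))).
  - intros r; symmetry; apply incrementE.
  - apply (continuous_plus (V := R_NormedModule)); apply continuous_inner;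
      apply continuous_diff;
      first [apply continuous_sol_Bu | apply continuous_sol_v].
Qed.

(** [sqr_norm_near] passes from window integrals to [h] times increments of [z] at the cost of a
    factor 2, once for the energy and once for the forcing; the estimate with [1/5] still leaves
    [1/5] of the integral on the left. *)
Lemma increment_integral_le (s eps : R) : 0 < eps ->
  RInt (increment s) 0 T <= 96 * T * eps ^ 2.
Proof.
  intros Heps.
  destruct (uniform_continuity s eps Heps) as (h & Hh & Hu).
  set (BW := diff s (diff h (primitive0 sol_Bu))).
  set (W1 := diff s (diff h sol_u)).
  set (Gam := diff s (diff h (primitive0 sol_f))).
  assert (Near : forall (G g : R -> X) (K t : R), 0 <= K -> 0 < t < T ->
    (forall a b, is_RInt g a b (minus (G b) (G a))) ->
    (forall r t, norm (minus (g r) (g t)) <= K * norm (minus (z r) (z t))) ->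
    norm (minus (diff s (diff h G) t) (scal h (diff s g t)))
    <= h * (2 * (K * eps))).
  { intros G g K t HK Ht HG Hg; apply diff_diff_approx; trivial;
      intros r Hr; (eapply Rle_trans; [apply Hg | ]);
      apply Rmult_le_compat_l; trivial; apply (Hu t r); lra. }
  assert (Hscal : forall x : X, norm (scal h x) ^ 2 = h ^ 2 * inner x x).
  { intros x; rewrite (norm_scal_Rabs (V := X)) inner_norm.
    rewrite Rabs_pos_eq; [ring | lra]. }
  (* Each comparison errs by at most [2 h eps], whose doubled square is [8 h^2 eps^2]; the two
     components give 16. *)
  assert (Hlow : forall t, 0 < t < T ->
    h ^ 2 * increment s t
    <= 2 * (inner (BW t) (BW t) + inner (W1 t) (W1 t))
       + 16 * h ^ 2 * eps ^ 2).
  { intros t Ht; rewrite incrementE.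
    assert (N1 : norm (minus (BW t) (scal h (diff s sol_Bu t)))
                 <= h * (2 * (1 * eps))).
    { apply Near; trivial; [lra | intros; apply is_RInt_primitive0 | ].
      - apply continuous_sol_Bu.
      - intros; rewrite Rmult_1_l; apply sol_Bu_le. }
    assert (N2 : norm (minus (W1 t) (scal h (diff s sol_v t)))
                 <= h * (2 * (1 * eps))).
    { apply Near; trivial; [lra | intros; apply is_RInt_sol_v | ].
      intros; rewrite Rmult_1_l; apply sol_v_le. }
    rewrite (norm_minus_sym (V := X)) in N1.
    rewrite (norm_minus_sym (V := X)) in N2.
    apply sqr_norm_near in N1; apply sqr_norm_near in N2.
    rewrite !Hscal -!inner_norm in N1, N2; nra. }
  assert (Hup : forall t, 0 < t < T ->
    inner (Gam t) (Gam t)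
    <= 2 * h ^ 2 * L ^ 2 * increment s t + 8 * h ^ 2 * L ^ 2 * eps ^ 2).
  { intros t Ht.
    assert (N : norm (minus (Gam t) (scal h (diff s sol_f t)))
                <= h * (2 * (L * eps))).
    { apply Near; trivial; [lra | intros; apply is_RInt_primitive0 | ].
      - apply continuous_sol_f.
      - apply sol_f_lipschitz. }
    apply sqr_norm_near in N; rewrite Hscal inner_norm in N.
    assert (HL2 : norm (diff s sol_f t) ^ 2 <= L ^ 2 * increment s t).
    { unfold increment; rewrite -Rpow_mult_distr.
      apply pow_incr; split; [apply (norm_ge_0 (V := X)) | ].
      apply sol_f_lipschitz. }
    apply (Rmult_le_compat_l (2 * h ^ 2)) in HL2; [ | nra].
    rewrite inner_norm; nra. }
  assert (cBW : forall t, continuous BW t).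
  { intros t; apply continuous_diff; intros r; apply continuous_diff.
    intros r'; apply (is_derive_continuous _ _ (sol_Bu r')).
    apply is_derive_primitive0, continuous_sol_Bu. }
  assert (cW1 : forall t, continuous W1 t).
  { intros t; apply continuous_diff; intros r; apply continuous_diff.
    apply continuous_sol_u. }
  assert (cG : forall t, continuous Gam t).
  { intros t; apply continuous_diff; intros r; apply continuous_diff.
    intros r'; apply (is_derive_continuous _ _ (sol_f r')).
    apply is_derive_primitive0, continuous_sol_f. }
  assert (HI := is_RInt_continuous (increment s) 0 T (continuous_increment s)).
  assert (HE := diff_diff_estimate s h Hh).
  fold BW W1 Gam in HE.
  assert (HEI : is_RInt (fun t => inner (BW t) (BW t) + inner (W1 t) (W1 t))
                  0 T (RInt (fun t => inner (BW t) (BW t)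
                                      + inner (W1 t) (W1 t)) 0 T)).
  { apply is_RInt_continuous; intros t.
    apply (continuous_plus (V := R_NormedModule)); now apply continuous_inner. }
  assert (HGI : is_RInt (fun t => inner (Gam t) (Gam t)) 0 T
                  (RInt (fun t => inner (Gam t) (Gam t)) 0 T)).
  { apply is_RInt_continuous; intros t; now apply continuous_inner. }
  revert HE HEI HGI HI.
  generalize
    (RInt (fun t => inner (BW t) (BW t) + inner (W1 t) (W1 t)) 0 T : R).
  generalize (RInt (fun t => inner (Gam t) (Gam t)) 0 T : R).
  generalize (RInt (increment s) 0 T : R).
  intros J N E HE HEI HGI HI.
  assert (I1 : h ^ 2 * J <= 2 * E + (T - 0) * (16 * h ^ 2 * eps ^ 2)).
  { apply (is_RInt_le (fun t => h ^ 2 * increment s t)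
      (fun t => 2 * (inner (BW t) (BW t) + inner (W1 t) (W1 t))
                + 16 * h ^ 2 * eps ^ 2) 0 T); [lra | | | exact Hlow].
    - now apply (is_RInt_scal (V := R_NormedModule)).
    - apply (is_RInt_plus (V := R_NormedModule));
        [now apply (is_RInt_scal (V := R_NormedModule))
        | apply (is_RInt_const (V := R_NormedModule))]. }
  assert (I2 : N <= 2 * h ^ 2 * L ^ 2 * J
                    + (T - 0) * (8 * h ^ 2 * L ^ 2 * eps ^ 2)).
  { apply (is_RInt_le (fun t => inner (Gam t) (Gam t))
      (fun t => 2 * h ^ 2 * L ^ 2 * increment s t
                + 8 * h ^ 2 * L ^ 2 * eps ^ 2) 0 T);
      [lra | trivial | | exact Hup].
    apply (is_RInt_plus (V := R_NormedModule));
      [now apply (is_RInt_scal (V := R_NormedModule))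
      | apply (is_RInt_const (V := R_NormedModule))]. }
  assert (HL2 : 0 < 5 * L ^ 2) by nra.
  apply (Rmult_le_compat_l (/ (5 * L ^ 2))) in I2;
    [ | now apply Rlt_le, Rinv_0_lt_compat].
  replace (/ (5 * L ^ 2) * (2 * h ^ 2 * L ^ 2 * J
             + (T - 0) * (8 * h ^ 2 * L ^ 2 * eps ^ 2)))
    with (h ^ 2 * (2 / 5 * J + 8 / 5 * T * eps ^ 2)) in I2 by (field; lra).
  (* Up to the factor [h^2], [I1], [HE] and [I2] combine to [J <= 4/5 J + (16 + 16/5) T eps^2], and
     [5 (16 + 16/5) = 96]. *)
  apply Rmult_le_reg_l with (h ^ 2 / 5); [nra | ].
  lra.
Qed.

Lemma sol_u_constant (s t : R) : sol_u s = sol_u t.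
Proof.
  (* [zero_of_RInt_zero] needs an interior time; as [s] is arbitrary, the single base point [T / 2]
     reaches every time. *)
  assert (H : forall s, sol_u (T / 2 + s) = sol_u (T / 2)).
  { clear s t; intros s.
    assert (HI : RInt (increment s) 0 T <= 0).
    { apply Rnot_lt_le; intros HJ.
      set (J := RInt (increment s) 0 T : R) in *.
      (* This [eps] turns the bound [96 T eps^2] into [J / 2]. *)
      assert (He : 0 < sqrt (J / (192 * T))).
      { apply sqrt_lt_R0, Rdiv_lt_0_compat; lra. }
      assert (H := increment_integral_le s _ He); fold J in H.
      rewrite pow2_sqrt in H;
        [ | apply Rlt_le, Rdiv_lt_0_compat; lra].
      replace (96 * T * (J / (192 * T))) with (J / 2) in H by (field; lra).
      lra. }
    assert (H : increment s (T / 2) = 0).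
    { apply (zero_of_RInt_zero _ T);
        [lra | apply continuous_increment | | trivial].
      intros t; apply pow2_ge_0. }
    assert (H0 : minus (z (T / 2 + s)) (z (T / 2)) = zero).
    { apply norm_eq_zero; apply Rsqr_0_uniq; rewrite Rsqr_pow2; exact H. }
    assert (E : z (T / 2 + s) = z (T / 2)).
    { apply (plus_reg_r (opp (z (T / 2)))); rewrite plus_opp_r; exact H0. }
    unfold sol_u; now rewrite E. }
  replace s with (T / 2 + (s - T / 2)) by ring.
  replace t with (T / 2 + (t - T / 2)) by ring.
  now rewrite !H.
Qed.

End PeriodicSolution.

Theorem theorem4 (X : HilbertSpace) (hX : separable X)
    (A : pos_self_adjoint X) (hA : compact_resolvent A)
    (sqrtA : pos_self_adjoint X) (hsqrtA : is_sqrt_op A sqrtA)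
    (alpha : R) (halpha : 0 < alpha)
    (S : R -> energy_space sqrtA -> energy_space sqrtA)
    (hS : C0_semigroup S)
    (hSA : is_generator (damped_wave_op A sqrtA alpha) S)
    (f : domain_space sqrtA -> X -> X) (L : R) (hL : 0 < L)
    (hf : forall (u1 u2 : domain_space sqrtA) (v1 v2 : X),
        norm (minus (f u1 v1) (f u2 v2))
        <= L * sqrt (norm (minus u1 u2) ^ 2 + norm (minus v1 v2) ^ 2))
    (T : R) (hT : 0 < T) (u : R -> X)
    (hu : periodic_solution sqrtA S f T u)
    (hnonstat : exists t1 t2, 0 <= t1 <= T /\ 0 <= t2 <= T /\ u t1 <> u t2) :
  T >= 1 / (L * (1 + sqrt ((1 + 1 / sqrt 2) * (1 + 2 / (alpha * L)))) ^ 2).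
Proof.
  apply Rle_ge, Rnot_lt_le; intros Hlt.
  destruct (period_bound_smallness alpha L T halpha hL hT Hlt) as [HTL HTa].
  destruct hu as (z & Eu & zd & zT & zc & zm).
  destruct hnonstat as (t1 & t2 & H1 & H2 & Hne).
  apply Hne; rewrite (Eu t1 H1) (Eu t2 H2).
  exact (sol_u_constant X A sqrtA hA hsqrtA alpha halpha S hS hSA f L hL hf
           z zd zc zm T hT zT HTL HTa t1 t2).
Qed.
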